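(* Let $S$ be a finite set, $\mathbb{A}=\{(x_0,x_1,x_2,\dots): x_i\in S\}$, and $\sigma:\mathbb{A}\to\mathbb{A}$ the left shift $\sigma(x_0,x_1,\dots)=(x_1,x_2,\dots)$. Fix $\theta\in(0,1)$ and equip $\mathbb{A}$ with the metric $d(x,y)=\theta^{\inf\{n\ge 0: x_n\neq y_n\}}$. Let $\phi_p:\mathbb{A}\to\mathbb{R}$ be a potential and $\|\phi_p\|\ge 1$ a number with $\|\phi_p\|_\infty\le\|\phi_p\|$ and $|\phi_p(x)-\phi_p(y)|\le \|\phi_p\|\,d(x,y)$ for all $x,y$, and assume $\phi_p$ is normalized: $\sum_{b\in S}e^{\phi_p(bx)}=1$ for every $x\in\mathbb{A}$. Let $\mu_{\phi_p}$ be the equilibrium state of $\phi_p$ (a $\sigma$-invariant probability measure), $\mathbb{E}$ the expectation with respect to $\mu_{\phi_p}$, and $P$ the transfer operator $P(\phi)(x)=\sum_{b\in S}e^{\phi_p(bx)}\phi(bx)$. Let $\phi:\mathbb{A}\to\mathbb{R}$ be an observable and $\|\phi\|\ge 1$ a number with $\|\phi\|_\infty\le\|\phi\|$ and $|\phi(x)-\phi(y)|\le\|\phi\|\,d(x,y)$ for all $x,y$. Let $a=1-\exp(-\|\phi_p\|(1-\theta)^{-1})$, let $\epsilon\in(0,\min\{1-a,1-\theta\})$, let \[U:=\frac{\log(1-\epsilon)}{\log[\theta\epsilon(1-\epsilon-\theta)]-\log(2\|\phi_p\|)},\] and let \[z_0\in\Big(1,\ \min\Big\{\Big(\frac{a+\epsilon/2}{a}\Big)^{U},\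 \frac{\theta+\epsilon}{\theta},\ \frac{1-\epsilon}{\theta},\ e^2\Big\}\Big).\] Then for every $n\ge 0$, \[\|P^n(\phi-\mathbb{E}\phi)\|_\infty\le \frac{(\sqrt{z_0})^{-n}}{(\log\sqrt{z_0})(1-a-\epsilon)}\,\|\phi\|.\]
   Context: For $b\in S$ and $x=(x_0,x_1,\dots)\in\mathbb{A}$, $bx$ denotes the sequence $(b,x_0,x_1,\dots)$. The quantities $\|\phi_p\|$ and $\|\phi\|$ are fixed numbers (at least $1$) bounding both the sup norm and the Lipschitz constant of the respective functions with respect to $d$. $\|\cdot\|_\infty$ is the sup norm. *)

(* Defs.v *)
From HB Require Import structures.
From mathcomp Require Import all_boot all_order all_algebra.
From mathcomp Require Import all_classical all_reals all_analysis.

Set Implicit Arguments.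
Unset Strict Implicit.
Unset Printing Implicit Defensive.

Import Order.TTheory GRing.Theory Num.Theory.
Import numFieldNormedType.Exports.
Local Open Scope classical_set_scope.
Local Open Scope ring_scope.

(* A finite alphabet S, equipped with a distinguished point (needed by the
   MathComp-Analysis measurable-seqspace interface; harmless since the
   normalization hypothesis forces S to be nonempty anyway). *)
HB.structure Definition FinPointed := {T of Finite T & isPointed T}.
Notation finPointedType := FinPointed.type.

Section Shift.
Variable S : finPointedType.

Definition shift (x : nat -> S) : nat -> S := fun n => x n.+1.

Definition scons (b : S) (x : nat -> S) : nat -> S :=
  fun n => if n is k.+1 then x k else b.

Definition cyl (n : nat) (w : 'I_n -> S) : set (nat -> S) :=
  [set x | forall i : 'I_n, x i = w i].

Definition cylinders : set (set (nat -> S)) :=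
  [set C | exists n (w : 'I_n -> S), C = cyl w].

Definition seqspace := g_sigma_algebraType cylinders.

End Shift.

Section Dyn.
Variables (R : realType) (S : finPointedType).

(* d(x,y) = theta^{inf {n | x_n <> y_n}}, with d(x,x) = theta^{+oo} = 0 *)
Definition dist (theta : R) (x y : nat -> S) : R :=
  match pselect (exists n, x n != y n) with
  | left H => theta ^+ ex_minn H
  | right _ => 0
  end.

Definition transfer (phip : (nat -> S) -> R) (f : (nat -> S) -> R) :
  (nat -> S) -> R :=
  fun x => \sum_(b : S) expR (phip (scons b x)) * f (scons b x).

Definition shift_invariant (mu : probability (seqspace S) R) : Prop :=
  forall A : set (seqspace S), measurable A ->
    mu (@shift S @^-1` A) = mu A.

(* H_mu( \/_{i<n} sigma^{-i} xi ), xi the time-zero partition: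
   entropy of the partition into n-cylinders (0 log 0 = 0) *)
Definition cyl_entropy (mu : probability (seqspace S) R) (n : nat) : R :=
  - \sum_(w : {ffun 'I_n -> S})
      fine (mu (@cyl S n w)) * ln (fine (mu (@cyl S n w))).

(* Kolmogorov-Sinai entropy h_mu(sigma), computed with the generating
   time-zero partition (Kolmogorov-Sinai generator theorem) *)
Definition ks_entropy (mu : probability (seqspace S) R) : R :=
  limn (fun n : nat => cyl_entropy mu n.+1 / n.+1%:R).

Definition expect (mu : probability (seqspace S) R) (f : (nat -> S) -> R) : R :=
  fine (\int[mu]_x (f x)%:E).

Definition equilibrium_state (phip : (nat -> S) -> R)
    (mu : probability (seqspace S) R) : Prop :=
  shift_invariant mu /\
  forall nu : probability (seqspace S) R, shift_invariant nu ->
    ks_entropy nu + expect nu phip <= ks_entropy mu + expect mu phip.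

End Dyn.

(* Main.v *)
Require Import Defs.
From HB Require Import structures.
From mathcomp Require Import all_boot all_order all_algebra.
From mathcomp Require Import all_classical all_reals all_analysis.
From mathcomp Require Import measurable_realfun ring lra.
Import Order.TTheory GRing.Theory Num.Theory.
Import numFieldNormedType.Exports.
Local Open Scope classical_set_scope.
Local Open Scope ring_scope.

(* Couple the backward chains started at [x] and [y]: if they agree on [k]
   letters, the next letter can be chosen equal with probability at least
   [exp (- Np theta^(k+1))]; otherwise the coupling restarts. The times between
   restarts form a defective renewal process of total mass at most [a], and for
   [z0] as in the statement the generating function of its law is at most
   [a + eps] at [z0], so the renewal equation makes the oscillation of [P^n phi]
   decay like [z0^(-n) / (1 - a - eps)].

   It remains to see that [E (P f) = E f]. The limits of [P^k] of indicators of
   cylinders define an invariant Gibbs measure, realized on [[0, 1[] by nested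
   intervals, for which entropy plus the integral of [phip] is nonnegative; hence
   the same holds for the equilibrium state [mu]. On the other hand this quantity
   is bounded above by minus the relative entropy of the one-step conditional
   weights of [mu] with respect to [exp phip], up to an error [Np theta^(n+1)];
   so the relative entropy tends to 0, which forces [E (P f) = E f]. *)

Set Implicit Arguments.
Unset Strict Implicit.
Unset Printing Implicit Defensive.

(** * Contraction by coupling *)

Definition agree (T : Type) (n : nat) (x y : nat -> T) :=
  forall i, (i < n)%N -> x i = y i.

Definition var_le (R : realType) (S : finPointedType) (theta C : R)
    (f : (nat -> S) -> R) :=
  forall n x y, agree n x y -> `|f x - f y| <= C * theta ^+ n.

Section Words.
Variables (R : realType) (S : finPointedType).
Implicit Types (x y : nat -> S).

Lemma agree0 x y : agree 0 x y.
Proof. by []. Qed.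

Lemma agree_sym n x y : agree n x y -> agree n y x.
Proof. by move=> h i /h. Qed.

Lemma agree_trans n x y z : agree n x y -> agree n y z -> agree n x z.
Proof. by move=> h k i lt_in; rewrite h// k. Qed.

Lemma agree_scons n b x y : agree n x y -> agree n.+1 (scons b x) (scons b y).
Proof. by move=> h [|i] //= /h. Qed.

Lemma agree_dist (theta : R) n x y : 0 <= theta <= 1 -> agree n x y ->
  dist theta x y <= theta ^+ n.
Proof.
move=> /andP[t0 t1] h; rewrite /dist; case: pselect => [H|_]; last exact: exprn_ge0.
case: ex_minnP => m xym _; apply: ler_wiXn2l => //.
by rewrite leqNgt; apply/negP => /h xy; rewrite xy eqxx in xym.
Qed.

Lemma lip_var_le (theta C : R) (f : (nat -> S) -> R) : 0 <= theta <= 1 -> 0 <= C ->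
  (forall x y, `|f x - f y| <= C * dist theta x y) -> var_le theta C f.
Proof.
move=> t01 C0 h n x y xy; apply: le_trans (h x y) _.
by rewrite ler_wpM2l// agree_dist.
Qed.

End Words.

Section Contraction.
Variables (R : realType) (S : finPointedType) (theta Np : R).
Variable phip : (nat -> S) -> R.
Hypothesis theta01 : 0 < theta < 1.
Hypothesis Np0 : 0 <= Np.
Hypothesis phip_var : var_le theta Np phip.
Hypothesis phip_norm : forall x, \sum_(b : S) expR (phip (scons b x)) = 1.

Local Notation P := (transfer phip).
Implicit Types (f : (nat -> S) -> R) (x y : nat -> S).

Definition keep k : R := expR (- (Np * theta ^+ k.+1)).

Let theta_ge0 : 0 <= theta. Proof. by case/andP: theta01 => /ltW. Qed.

Lemma keep_ge0 k : 0 <= keep k. Proof. exact: expR_ge0. Qed.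

Lemma keep_le1 k : keep k <= 1.
Proof. by rewrite /keep expR_le1 oppr_le0 mulr_ge0// exprn_ge0. Qed.

Lemma keep_ge k : 1 - Np * theta ^+ k.+1 <= keep k.
Proof. exact: expR_ge1Dx. Qed.

Lemma transfer_coupling f A B k :
  (forall x y, agree k.+1 x y -> f x - f y <= A) ->
  (forall x y, f x - f y <= B) ->
  forall x y, agree k x y -> P f x - P f y <= keep k * A + (1 - keep k) * B.
Proof.
move=> hA hB x y xy.
pose g b := expR (phip (scons b x)); pose h b := expR (phip (scons b y)).
pose q b := Num.min (g b) (h b); pose Q := \sum_b q b.
have qg b : q b <= g b by rewrite /q ge_min lexx.
have qh b : q b <= h b by rewrite /q ge_min lexx orbT.
have q0 b : 0 <= q b by rewrite /q le_min !expR_ge0.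
have keepQ : keep k <= Q.
  have -> : keep k = \sum_b keep k * g b by rewrite -mulr_sumr phip_norm mulr1.
  apply: ler_sum => b _; rewrite /q le_min; apply/andP; split.
    by rewrite ler_piMl ?expR_ge0// keep_le1.
  rewrite /keep /g /h -expRD ler_expR addrC lerBlDr -lerBlDl.
  apply: le_trans (ler_norm _) _.
  exact: (phip_var (agree_scons b xy)).
have Q1 : Q <= 1 by rewrite -(phip_norm x); apply: ler_sum => b _; exact: qg.
have sg : \sum_b (g b - q b) = 1 - Q by rewrite sumrB phip_norm.
have sh : \sum_b (h b - q b) = 1 - Q by rewrite sumrB phip_norm.
set bm := [arg max_(b > (point : S)) f (scons b x)]%O.
have bmP b : f (scons b x) <= f (scons bm x).
  by rewrite /bm; case: arg_maxP => // i _; exact.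
pose M := f (scons bm x).
have -> : P f x - P f y = \sum_b q b * (f (scons b x) - f (scons b y)) +
   \sum_b (g b - q b) * f (scons b x) - \sum_b (h b - q b) * f (scons b y).
  rewrite /transfer -!sumrB -big_split/= -sumrB; apply: eq_bigr => b _.
  by rewrite -/(g b) -/(h b); ring.
pose A' := Num.min A B.
have h1 : \sum_b q b * (f (scons b x) - f (scons b y)) <= Q * A'.
  rewrite mulr_suml; apply: ler_sum => b _; rewrite ler_wpM2l// /A' le_min hB.
  by rewrite hA//; exact: agree_scons.
have h2 : \sum_b (g b - q b) * f (scons b x) <= (1 - Q) * M.
  rewrite -sg mulr_suml; apply: ler_sum => b _.
  by rewrite ler_wpM2l ?subr_ge0 ?qg ?bmP.
have h3 : (1 - Q) * (M - B) <= \sum_b (h b - q b) * f (scons b y).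
  rewrite -sh mulr_suml; apply: ler_sum => b _.
  by rewrite ler_wpM2l ?subr_ge0 ?qh// lerBlDr -lerBlDl hB.
have A'B : A' <= B by rewrite ge_min lexx orbT.
have A'A : A' <= A by rewrite ge_min lexx.
have p0 := keep_ge0 k.
have : 0 <= (Q - keep k) * (B - A') by rewrite mulr_ge0 ?subr_ge0.
have : 0 <= keep k * (A - A') by rewrite mulr_ge0 ?subr_ge0.
by lra.
Qed.

Lemma transfer_bound f F : (forall x, `|f x| <= F) -> forall x, `|P f x| <= F.
Proof.
move=> hF x; apply: le_trans (ler_norm_sum _ _ _) _.
rewrite -[leRHS]mul1r -(phip_norm x) mulr_suml; apply: ler_sum => b _.
by rewrite normrM (ger0_norm (expR_ge0 _)) ler_wpM2l// expR_ge0.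
Qed.

Lemma transfer_cst c : P (fun=> c) = fun=> c.
Proof. by apply/funext => x; rewrite /transfer -mulr_suml phip_norm mul1r. Qed.

Lemma transfer_scale_sub c f g : P (fun x => f x - c * g x) = (fun x => P f x - c * P g x).
Proof.
apply/funext => x; rewrite /transfer mulr_sumr -sumrB; apply: eq_bigr => b _.
by ring.
Qed.

Lemma transfer_le f g : (forall x, f x <= g x) -> forall x, P f x <= P g x.
Proof.
by move=> fg x; apply: ler_sum => b _; rewrite ler_wpM2l// expR_ge0.
Qed.

Lemma iter_transfer_bound f F n : (forall x, `|f x| <= F) ->
  forall x, `|iter n P f x| <= F.
Proof. by move=> hF; elim: n => [|n IH]//=; exact: transfer_bound. Qed.

Lemma iter_transfer_osc f n m e :
  (forall x y, `|iter n P f x - iter n P f y| <= e) ->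
  forall x y, `|iter (n + m) P f x - iter n P f y| <= e.
Proof.
move=> he x y; rewrite addnC iterD; move: (iter n P f) he => h he.
elim: m x => [|m IH] x /=; first exact: he.
have -> : P (iter m P h) x - h y = P (fun z => iter m P h z - h y * 1) x.
  by rewrite (transfer_scale_sub (h y) _ (fun=> 1)) transfer_cst mulr1.
by apply: transfer_bound => z; rewrite mulr1.
Qed.

Lemma var_le_transfer f C F : 0 <= C -> (forall x, `|f x| <= F) ->
  var_le theta C f -> var_le theta (C + F * 2 * Np) (P f).
Proof.
move=> C0 hF hC n.
have F0 : 0 <= F by exact: le_trans (hF (fun=> point)).
have key x y : agree n x y -> P f x - P f y <= (C + F * 2 * Np) * theta ^+ n.
  move=> xy.
  have := @transfer_coupling f (C * theta ^+ n.+1) (F * 2) n.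
  move=> /(_ _ _ x y xy) /= H; apply: le_trans (H _ _) _.
  - by move=> u v uv; apply: le_trans (ler_norm _) (hC _ _ _ uv).
  - move=> u v; have := hF u; have := hF v; rewrite !ler_norml.
    by move=> /andP[? ?] /andP[? ?]; lra.
  have ht : theta ^+ n.+1 <= theta ^+ n.
    by rewrite exprS ler_piMl ?exprn_ge0//; case/andP: theta01 => _ /ltW.
  rewrite [leRHS]mulrDl lerD//.
    apply: (@le_trans _ _ (C * theta ^+ n.+1)).
      by rewrite ler_piMl ?keep_le1// mulr_ge0// exprn_ge0.
    exact: ler_wpM2l.
  rewrite mulrC -[leRHS]mulrA ler_wpM2l ?mulr_ge0//.
  have := keep_ge n; have := ler_wpM2l Np0 ht; lra.
move=> x y xy; rewrite ler_norml key// andbT lerNl opprB.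
exact/key/agree_sym.
Qed.

(* The bound on the variation over words agreeing on [k] letters after [n]
   steps of the coupling: with probability [keep k] the agreement grows by one
   letter, otherwise the coupling restarts from no agreement. *)
Fixpoint coupled_var (C : R) n k : R :=
  if n is n'.+1 then
    keep k * coupled_var C n' k.+1 + (1 - keep k) * coupled_var C n' 0
  else C * theta ^+ k.

Lemma iter_transfer_coupled_var f C : var_le theta C f ->
  forall n k x y, agree k x y ->
    iter n P f x - iter n P f y <= coupled_var C n k.
Proof.
move=> fC; elim=> [|n IH] k x y xy /=.
  exact: le_trans (ler_norm _) (fC _ _ _ xy).
by apply: transfer_coupling xy => u v; [exact: IH | exact/IH/agree0].
Qed.

Definition survive m : R := \prod_(i < m) keep i.

Lemma survive_ge0 m : 0 <= survive m.
Proof. by apply: prodr_ge0 => i _; exact: keep_ge0. Qed.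

Lemma survive_le1 m : survive m <= 1.
Proof. by apply: prodr_ile1 => i _; rewrite keep_ge0 keep_le1. Qed.

Lemma surviveS m : survive m.+1 = survive m * keep m.
Proof. by rewrite /survive big_ord_recr. Qed.

Lemma survive_ge m : expR (- (Np / (1 - theta))) <= survive m.
Proof.
have h : survive m = expR (- (Np * \sum_(i < m) theta ^+ i.+1)).
  elim: m => [|m IH]; first by rewrite /survive !big_ord0 mulr0 oppr0 expR0.
  by rewrite surviveS IH big_ord_recr/= mulrDr opprD expRD.
rewrite h ler_expR lerN2 ler_wpM2l//.
have t1 : 0 < 1 - theta by rewrite subr_gt0; case/andP: theta01.
rewrite -[leRHS]div1r ler_pdivlMr//.
have -> : \sum_(i < m) theta ^+ i.+1 = theta * \sum_(i < m) theta ^+ i.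
  by rewrite mulr_sumr; apply: eq_bigr => i _; rewrite exprS.
have := subrX1 theta m.
have : 0 <= theta ^+ m by exact: exprn_ge0.
case/andP: theta01 => t0 t1' ? E.
have : theta ^+ m <= 1 by rewrite exprn_ile1// ltW.
move=> ?.
have -> : theta * (\sum_(i < m) theta ^+ i) * (1 - theta) = theta * (1 - theta ^+ m).
  by rewrite -mulrA; congr (_ * _); lra.
apply: (@le_trans _ _ (1 * 1)); last by rewrite mulr1.
by rewrite ler_pM//; lra.
Qed.

Definition fail_at j : R := survive j - survive j.+1.

Lemma fail_at_ge0 j : 0 <= fail_at j.
Proof.
by rewrite subr_ge0 surviveS ler_piMr ?survive_ge0 ?keep_le1.
Qed.

Lemma fail_at_le j : fail_at j <= Np * theta ^+ j.+1.
Proof.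
rewrite /fail_at surviveS -{1}[survive j]mulr1 -mulrBr.
have := keep_ge j; have := keep_le1 j; have := survive_le1 j.
have := survive_ge0 j => ? ? ? ?.
apply: (@le_trans _ _ (1 - keep j)); last by lra.
by rewrite ler_piMl// subr_ge0.
Qed.

Lemma sum_fail_at_le n : \sum_(j < n) fail_at j <= 1 - expR (- (Np / (1 - theta))).
Proof.
have -> : \sum_(j < n) fail_at j = 1 - survive n.
  elim: n => [|n IH]; first by rewrite big_ord0 /survive big_ord0 subrr.
  by rewrite big_ord_recr /= IH /fail_at; ring.
by rewrite lerD2l lerN2 survive_ge.
Qed.

Lemma coupled_var_renewal C n : coupled_var C n 0 =
  survive n * (C * theta ^+ n) +
  \sum_(j < n) fail_at j * coupled_var C (n.-1 - j) 0.
Proof.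
suff H m k : coupled_var C (k + m) 0 = survive m * coupled_var C k m +
    \sum_(j < m) fail_at j * coupled_var C ((k + m).-1 - j) 0.
  by have := H n 0%N; rewrite add0n.
elim: m k => [|m IH] k.
  by rewrite big_ord0 addr0 /survive big_ord0 mul1r addn0.
rewrite -addSnnS IH big_ord_recr /= addrA [in RHS]addrAC; congr (_ + _).
  rewrite addnK /fail_at surviveS; ring.
Qed.

Lemma coupled_var_decay C c z : 0 <= C -> c < 1 -> 1 <= z -> theta * z <= 1 ->
  (forall n, \sum_(j < n) fail_at j * z ^+ j.+1 <= c) ->
  forall n, coupled_var C n 0 <= C / (1 - c) * z ^- n.
Proof.
move=> C0 c1 z1 tz hc n.
have z0 : 0 < z by exact: lt_le_trans z1.
have c1' : 0 < 1 - c by rewrite subr_gt0.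
have K0 : 0 <= C / (1 - c) by rewrite divr_ge0// ltW.
have tzn m : theta ^+ m <= z ^- m.
  by rewrite -[leRHS]mul1r ler_pdivlMr ?exprn_gt0// -exprMn exprn_ile1// mulr_ge0// ltW.
elim/ltn_ind: n => n IH; rewrite coupled_var_renewal.
have h1 : survive n * (C * theta ^+ n) <= C * z ^- n.
  rewrite (@le_trans _ _ (C * theta ^+ n))//; last exact: ler_wpM2l.
  by rewrite ler_piMl ?survive_le1// mulr_ge0// exprn_ge0.
have h2 : \sum_(j < n) fail_at j * coupled_var C (n.-1 - j) 0 <=
    C / (1 - c) * z ^- n * c.
  apply: (@le_trans _ _ (C / (1 - c) * z ^- n * \sum_(j < n) fail_at j * z ^+ j.+1)).
    rewrite mulr_sumr; apply: ler_sum => j _.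
    rewrite [leRHS]mulrCA ler_wpM2l ?fail_at_ge0//.
    have jn := ltn_ord j; have lt_n : (n.-1 - j < n)%N.
      by rewrite (leq_ltn_trans (leq_subr _ _))// prednK// (leq_ltn_trans _ jn).
    apply: le_trans (IH _ lt_n) _; rewrite -[leRHS]mulrA ler_wpM2l//.
    have -> : (n.-1 - j = n - j.+1)%N by rewrite subnS -subn1 subnAC subn1.
    have -> : z ^- n = z ^- (n - j.+1) * z ^- j.+1 by rewrite -invfM -exprD subnK.
    by rewrite -mulrA mulVf ?mulr1// gt_eqF// exprn_gt0.
  by rewrite ler_wpM2l// mulr_ge0// invr_ge0 exprn_ge0// ltW.
apply: le_trans (lerD h1 h2) _.
have -> : C * z ^- n = C / (1 - c) * z ^- n * (1 - c).
  by field; rewrite gt_eqF ?exprn_gt0 ?gt_eqF.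
by rewrite -mulrDr subrK mulr1.
Qed.

Lemma iter_transfer_decay f C c z : var_le theta C f -> 0 <= C -> c < 1 ->
  1 <= z -> theta * z <= 1 ->
  (forall n, \sum_(j < n) fail_at j * z ^+ j.+1 <= c) ->
  forall n x y, `|iter n P f x - iter n P f y| <= C / (1 - c) * z ^- n.
Proof.
move=> fC C0 c1 z1 tz hc n x y; have key := coupled_var_decay C0 c1 z1 tz hc n.
rewrite ler_norml lerNl opprB.
by apply/andP; split; apply: le_trans key; apply: (iter_transfer_coupled_var fC); exact: agree0.
Qed.

End Contraction.

Lemma geometric_tail_le (R : realType) (q r M : R) n :
  0 <= q -> q <= r -> 0 < r <= 1 ->
  \sum_(j < n | M < j.+1%:R) q ^+ j.+1 * (1 - q) <= r `^ M.
Proof.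
move=> q0 qr /andP[r0 r1].
have hr k : M < k%:R -> q ^+ k <= r `^ M.
  move=> Mk; apply: (@le_trans _ _ (r ^+ k)); first by rewrite lerXn2r ?nnegrE// ltW.
  by rewrite -powR_mulrn ?(ltW r0)//; apply: ger_powR; [rewrite r0|exact: ltW].
pose T k := \sum_(j < k | M < j.+1%:R) q ^+ j.+1 * (1 - q).
suff : if M < n.+1%:R then T n + q ^+ n.+1 <= r `^ M else T n == 0.
  case: ifPn => _; last by rewrite -/(T n) => /eqP ->; exact: powR_ge0.
  by apply: le_trans; rewrite lerDl exprn_ge0.
elim: n => [|n IH]; first by rewrite /T !big_ord0 add0r eqxx; case: ifPn => // /hr.
have TS : T n.+1 = T n + if M < n.+1%:R then q ^+ n.+1 * (1 - q) else 0.
  by rewrite /T big_mkcond big_ord_recr -big_mkcond.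
rewrite TS; case: ifPn IH => Mn IH.
  rewrite (lt_trans Mn) ?ltr_nat// -addrA.
  by rewrite [q ^+ n.+2]exprSr -mulrDr subrK mulr1.
by rewrite addr0 (eqP IH) add0r eqxx; case: ifPn => // /hr.
Qed.

Lemma fail_genfun_le (R : realType) (theta Np eps z : R) :
  0 < theta < 1 -> 1 <= Np ->
  let a := 1 - expR (- (Np / (1 - theta))) in
  0 < eps < Num.min (1 - a) (1 - theta) ->
  let U := ln (1 - eps) /
           (ln (theta * eps * (1 - eps - theta)) - ln (2 * Np)) in
  1 < z -> z < ((a + eps / 2) / a) `^ U -> z < (theta + eps) / theta ->
  z < (1 - eps) / theta ->
  forall n, \sum_(j < n) fail_at theta Np j * z ^+ j.+1 <= a + eps.
Proof.
move=> t01 Np1 a /andP[e0]; rewrite lt_min => /andP[ea et] U z1 zU zt ze n.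
have Np0 : 0 <= Np by exact: le_trans Np1.
have /andP[t0 t1] := t01.
have a0 : 0 < a by rewrite subr_gt0 expR_lt1 oppr_lt0 divr_gt0 ?subr_gt0// (lt_le_trans _ Np1).
have a1 : a < 1 by rewrite gtrBl expR_gt0.
have z0 : 0 < z by exact: lt_trans z1.
move: zt ze; rewrite !ltr_pdivlMr// => zt ze.
pose W := theta * eps * (1 - eps - theta).
have W0 : 0 < W by rewrite /W !mulr_gt0//; lra.
have W1 : W < 1.
  rewrite (@lt_trans _ _ (theta * eps))//; first by rewrite /W gtr_pMr ?mulr_gt0//; lra.
  by rewrite mulr_ilt1 ?ltW//; lra.
pose L := ln W - ln (2 * Np).
have Np20 : 0 < 2 * Np by lra.
have L0 : L < 0.
  have : ln W < 0 by rewrite ln_lt0// W0.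
  by have : 0 <= ln (2 * Np) by [apply: ln_ge0; lra]; rewrite /L; lra.
have l0 : ln (1 - eps) < 0 by rewrite ln_lt0//; apply/andP; split; lra.
have UE : U = ln (1 - eps) / L by [].
have U0 : 0 < U by rewrite UE -[X in X / _]opprK -[X in _ / X]opprK invrN mulrNN divr_gt0 ?oppr_gt0.
pose M := U^-1.
have eM : (1 - eps) `^ M = W / (2 * Np).
  rewrite /powR gt_eqF; last by lra.
  rewrite /M UE invf_div divfK ?lt_eqF// /L -ln_div ?posrE// lnK// posrE.
  exact: divr_gt0.
have small j : j.+1%:R <= M -> z ^+ j.+1 <= (a + eps / 2) / a.
  move=> jM; have ae0 : 0 < (a + eps / 2) / a by rewrite divr_gt0//; lra.
  rewrite -ler_ln ?posrE ?exprn_gt0// lnXn// -[leLHS]mulr_natl.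
  have lz : ln z <= U * ln ((a + eps / 2) / a).
    by rewrite -ln_powR ler_ln ?posrE ?powR_gt0// ltW.
  apply: (@le_trans _ _ (M * ln z)); first by rewrite ler_wpM2r// ln_ge0// ltW.
  by rewrite /M mulrC ler_pdivrMr// mulrC.
pose q := theta * z.
have q0 : 0 <= q by rewrite mulr_ge0// ltW.
have := @geometric_tail_le R q (1 - eps) M n q0.
rewrite -mulr_suml eM => /(_ _ _); set T := \sum_(_ < n | _) _ => tail.
have {}tail : T * (1 - q) <= W / (2 * Np).
  by apply: tail; rewrite /q; lra.
have T0 : 0 <= T by apply: sumr_ge0 => j _; exact: exprn_ge0.
have tail2 : Np * T <= theta * eps / 2.
  have : T * (1 - eps - theta) <= W / (2 * Np).
    by apply: le_trans tail; rewrite ler_wpM2l// /q; lra.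
  rewrite ler_pdivlMr// /W [in X in _ <= X -> _]mulrC => H.
  rewrite ler_pdivlMr// -(@ler_pM2r _ (1 - eps - theta)); last by lra.
  by lra.
have : \sum_(j < n) fail_at theta Np j * z ^+ j.+1 <=
    (\sum_(j < n) fail_at theta Np j) * ((a + eps / 2) / a) + Np * T.
  have -> : T = \sum_(j < n) (if M < j.+1%:R then q ^+ j.+1 else 0).
    by rewrite /T big_mkcond.
  rewrite mulr_suml mulr_sumr -big_split/=; apply: ler_sum => j _.
  have f0 := fail_at_ge0 t01 Np0 j.
  have ae0 : 0 <= (a + eps / 2) / a by rewrite divr_ge0//; lra.
  case: ifPn => [_|].
    rewrite -[leLHS]add0r; apply: lerD; first exact: mulr_ge0.
    rewrite /q exprMn mulrA; apply: ler_wpM2r; first by rewrite exprn_ge0// ltW.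
    exact: fail_at_le.
  by rewrite -leNgt mulr0 addr0 => /small h; rewrite ler_wpM2l.
have : (\sum_(j < n) fail_at theta Np j) * ((a + eps / 2) / a) <= a + eps / 2.
  rewrite -[leRHS](@divfK _ a) ?gt_eqF// mulrC ler_wpM2l ?divr_ge0//; [lra..|].
  exact: sum_fail_at_le.
have : theta * eps <= eps by rewrite ler_piMl ?ltW.
by lra.
Qed.

(** * Entropy of invariant cylinder weights *)

Lemma geometric_cvg0 (R : realType) (theta C : R) : 0 < theta < 1 ->
  (fun n => C * theta ^+ n) @ \oo --> (0 : R).
Proof.
move=> theta01; rewrite -(mulr0 C); apply: cvgM; first exact: cvg_cst.
apply: cvg_expr.
by case/andP: theta01 => ? ?; rewrite ger0_norm// ltW.
Qed.

Lemma expR_le_quad (R : realType) (u : R) : `|u| <= 1 / 2 -> expR u <= 1 + u + 2 * u ^+ 2.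
Proof.
rewrite ler_norml => /andP[u1 u2].
have h : 1 - u <= (expR u)^-1 by rewrite -expRN; exact: expR_ge1Dx.
have u0 : 0 < 1 - u by lra.
rewrite -[expR u]invrK (@le_trans _ _ (1 - u)^-1)//.
  by rewrite lef_pV2 ?posrE// invr_gt0 expR_gt0.
rewrite -[leLHS]div1r ler_pdivrMr//.
have : 0 <= u ^+ 2 * (1 - 2 * u) by rewrite mulr_ge0 ?sqr_ge0//; lra.
by nra.
Qed.

Lemma mul_lnB_ge (R : realType) (p r : R) : 0 <= p -> 0 <= r ->
  (r = 0 -> p = 0) -> p - r <= p * (ln p - ln r).
Proof.
rewrite le_eqVlt => /orP[/eqP <- r0 _|p0]; first by rewrite mul0r sub0r oppr_le0.
rewrite le_eqVlt => /orP[/eqP <- /(_ erefl) p00|r0 _]; first by rewrite p00 ltxx in p0.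
have := @le_ln1Dx R (r / p - 1); rewrite addrCA subrr addr0 ln_div ?posrE//.
have -> : -1 < r / p - 1 by have := divr_gt0 r0 p0; lra.
move=> /(_ erefl) h.
have -> : p - r = - (p * (r / p - 1)) by field; rewrite gt_eqF.
by rewrite -(opprB (ln r)) mulrN lerN2 ler_pM2l.
Qed.

Lemma sumr_eq0_ge0 (R : realType) (I : finType) (p : I -> R) :
  (forall i, 0 <= p i) -> \sum_i p i = 0 -> forall i, p i = 0.
Proof.
move=> p0 /eqP; rewrite psumr_eq0// => /allP h i.
by have := h i; rewrite mem_index_enum => /(_ isT)/implyP/(_ isT)/eqP.
Qed.

Lemma log_sum (R : realType) (I : finType) (p q : I -> R) :
  (forall i, 0 <= p i) -> (forall i, 0 <= q i) -> (forall i, q i = 0 -> p i = 0) ->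
  (\sum_i p i) * (ln (\sum_i p i) - ln (\sum_i q i)) <=
  \sum_i p i * (ln (p i) - ln (q i)).
Proof.
move=> p0 q0 qp; set A := \sum_i p i; set B := \sum_i q i.
have : 0 <= A by exact: sumr_ge0.
rewrite le_eqVlt => /orP[/eqP A0|A0].
  rewrite -A0 mul0r big1// => i _.
  by rewrite (sumr_eq0_ge0 p0 (esym A0)) mul0r.
have B0 : 0 < B.
  have : 0 <= B by exact: sumr_ge0.
  rewrite le_eqVlt => /orP[/eqP B0|//].
  suff A00 : A = 0 by rewrite A00 ltxx in A0.
  by apply: big1 => i _; apply: qp; exact: sumr_eq0_ge0 (esym B0) i.
apply: (@le_trans _ _ (\sum_i (p i - q i * (A / B) + p i * (ln A - ln B)))).
  rewrite big_split/= sumrB -!mulr_suml -/A -/B mulrCA mulfV ?gt_eqF//.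
  by rewrite mulr1 subrr add0r.
apply: ler_sum => i _; have := q0 i; rewrite le_eqVlt => /orP[/eqP qi0|qi0].
  by rewrite (qp i)// -?qi0// !mul0r subrr add0r.
have AB0 : 0 < A / B by rewrite divr_gt0.
have r0 : 0 < q i * (A / B) by rewrite mulr_gt0.
have := mul_lnB_ge (p0 i) (ltW r0) _.
rewrite lnM ?posrE// ln_div ?posrE// => /(_ _) h.
rewrite -lerBrDr; apply: le_trans (h _) _; first by move=> e; rewrite e ltxx in r0.
by rewrite -mulrBr ler_wpM2l//; lra.
Qed.

Section WordSums.
Variables (R : realType) (S : finPointedType).
Implicit Types (x y : nat -> S) (F G : (nat -> S) -> R).

Fixpoint wsum n F : R :=
  if n is n'.+1 then \sum_(b : S) wsum n' (fun y => F (scons b y))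
  else F (fun=> point).

Definition snoc n y (c : S) : nat -> S := fun i => if i == n then c else y i.

Lemma scons_snoc n b y c : scons b (snoc n y c) = snoc n.+1 (scons b y) c.
Proof. by apply/funext => -[|i]. Qed.

Lemma agree_snoc n y c : agree n (snoc n y c) y.
Proof. by move=> i lt_in; rewrite /snoc ltn_eqF. Qed.

Lemma wsum_snoc n F : wsum n.+1 F = wsum n (fun y => \sum_c F (snoc n y c)).
Proof.
elim: n F => [|n IH] F.
  rewrite /=; apply: eq_bigr => b _; congr F.
  by apply/funext => -[|i].
rewrite -[LHS]/(\sum_b wsum n.+1 (fun y => F (scons b y))).
rewrite (eq_bigr _ (fun b _ => IH _)) /=; apply: eq_bigr => b _.
by congr wsum; apply/funext => y; apply: eq_bigr => c _; rewrite scons_snoc.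
Qed.

Lemma eq_wsum n F G : F =1 G -> wsum n F = wsum n G.
Proof. by move=> /funext ->. Qed.

Lemma wsumD n F G : wsum n (fun y => F y + G y) = wsum n F + wsum n G.
Proof.
elim: n F G => [//|n IH] F G /=; rewrite -big_split/=.
by apply: eq_bigr => b _; rewrite IH.
Qed.

Lemma wsumZ n c F : wsum n (fun y => c * F y) = c * wsum n F.
Proof.
elim: n F => [//|n IH] F /=; rewrite mulr_sumr.
by apply: eq_bigr => b _; rewrite IH.
Qed.

Lemma wsumN n F : wsum n (fun y => - F y) = - wsum n F.
Proof. by rewrite -mulN1r -wsumZ; apply: eq_wsum => y; rewrite mulN1r. Qed.

Lemma wsumB n F G : wsum n (fun y => F y - G y) = wsum n F - wsum n G.
Proof. by rewrite wsumD wsumN. Qed.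

Lemma wsum_sum n (H : S -> (nat -> S) -> R) :
  wsum n (fun y => \sum_b H b y) = \sum_b wsum n (H b).
Proof.
elim: n H => [//|n IH] H /=; rewrite exchange_big/=.
by apply: eq_bigr => b _; rewrite IH.
Qed.

Lemma wsumS n F : wsum n.+1 F = wsum n (fun y => \sum_b F (scons b y)).
Proof. by rewrite wsum_sum. Qed.

Lemma wsum_le n F G : (forall y, F y <= G y) -> wsum n F <= wsum n G.
Proof.
elim: n F G => [|n IH] F G FG /=; first exact: FG.
by apply: ler_sum => b _; apply: IH => y; exact: FG.
Qed.

Lemma wsum_ge0 n F : (forall y, 0 <= F y) -> 0 <= wsum n F.
Proof.
elim: n F => [|n IH] F F0 /=; first exact: F0.
by apply: sumr_ge0 => b _; apply: IH => y; exact: F0.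
Qed.

End WordSums.

(* The masses [M n y] of the cylinders of length [n] around [y] under a
   shift-invariant probability; [weights_scons] expresses invariance. *)
Record invariant_weights (R : realType) (S : finPointedType)
    (M : nat -> (nat -> S) -> R) : Prop := InvariantWeights {
  weights_ge0 : forall n y, 0 <= M n y ;
  weights_agree : forall n x y, agree n x y -> M n x = M n y ;
  weights0 : forall y, M 0%N y = 1 ;
  weights_snoc : forall n y, M n y = \sum_c M n.+1 (snoc n y c) ;
  weights_scons : forall n y, M n y = \sum_b M n.+1 (scons b y) }.

Section Entropy.
Variables (R : realType) (S : finPointedType) (M : nat -> (nat -> S) -> R).
Hypothesis hM : invariant_weights M.
Implicit Types (x y : nat -> S).

Let M0 := weights_ge0 hM.

Definition word_entropy n : R := - wsum n (fun y => M n y * ln (M n y)).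

Definition cond_entropy n : R := - wsum n (fun y =>
  \sum_b M n.+1 (scons b y) * (ln (M n.+1 (scons b y)) - ln (M n y))).

Lemma wsum_weights n : wsum n (M n) = 1.
Proof.
elim: n => [|n IH]; first exact: (weights0 hM).
by rewrite wsumS -IH; apply: eq_wsum => y; rewrite -weights_scons.
Qed.

Lemma weights_scons_le n b y : M n.+1 (scons b y) <= M n y.
Proof.
by rewrite (weights_scons hM n y) (bigD1 b)//= lerDl sumr_ge0.
Qed.

Lemma word_entropyS n : word_entropy n.+1 = word_entropy n + cond_entropy n.
Proof.
rewrite /word_entropy /cond_entropy wsumS -opprD -wsumD; congr (- _).
apply: eq_wsum => y; rewrite {1}(weights_scons hM n y) mulr_suml -big_split/=.
by apply: eq_bigr => b _; ring.
Qed.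

Lemma word_entropyE n : word_entropy n = \sum_(k < n) cond_entropy k.
Proof.
elim: n => [|n IH]; last by rewrite big_ord_recr /= -IH word_entropyS.
by rewrite big_ord0 /word_entropy /= (weights0 hM) ln1 mulr0 oppr0.
Qed.

Lemma cond_entropy_ge0 n : 0 <= cond_entropy n.
Proof.
rewrite /cond_entropy -wsumN; apply: wsum_ge0 => y.
rewrite -sumrN; apply: sumr_ge0 => b _; rewrite oppr_ge0.
have := M0 n.+1 (scons b y); rewrite le_eqVlt => /orP[/eqP <-|h]; first by rewrite mul0r.
rewrite mulr_ge0_le0 ?M0// subr_le0.
have h' := lt_le_trans h (weights_scons_le n b y).
by rewrite ler_ln ?posrE// weights_scons_le.
Qed.

Lemma cond_entropy_noninc n : cond_entropy n.+1 <= cond_entropy n.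
Proof.
rewrite /cond_entropy lerN2 wsum_snoc; apply: wsum_le => y.
rewrite [leRHS]exchange_big/=; apply: ler_sum => b _.
rewrite (weights_snoc hM n.+1 (scons b y)) (weights_snoc hM n y).
under [leRHS]eq_bigr do rewrite scons_snoc.
apply: log_sum => [c|c|c e]; rewrite ?M0//.
by apply/eqP; rewrite eq_le M0 andbT -scons_snoc -e weights_scons_le.
Qed.

Definition entropy_rate : R := limn cond_entropy.

Lemma cond_entropy_cvg : cond_entropy @ \oo --> entropy_rate.
Proof.
apply: nonincreasing_is_cvgn.
  by apply/nonincreasing_seqP => n; exact: cond_entropy_noninc.
by exists 0 => _ [n _ <-]; exact: cond_entropy_ge0.
Qed.

Lemma entropy_rate_le n : entropy_rate <= cond_entropy n.
Proof.
apply: nonincreasing_cvgn_ge; last by apply/cvg_ex; exists entropy_rate; exact: cond_entropy_cvg.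
by apply/nonincreasing_seqP => k; exact: cond_entropy_noninc.
Qed.

Lemma word_entropy_mean_cvg :
  (fun n => word_entropy n.+1 / n.+1%:R) @ \oo --> entropy_rate.
Proof.
have := cesaro cond_entropy_cvg.
rewrite (_ : arithmetic_mean _ = fun n => word_entropy n.+1 / n.+1%:R) //.
by apply/funext => n; rewrite word_entropyE /arithmetic_mean/= /series/= big_mkord mulrC.
Qed.

End Entropy.

Section Variational.
Variables (R : realType) (S : finPointedType) (theta Np : R).
Variable phip : (nat -> S) -> R.
Hypothesis theta01 : 0 < theta < 1.
Hypothesis Np0 : 0 <= Np.
Hypothesis phip_var : var_le theta Np phip.
Hypothesis phip_norm : forall x, \sum_(b : S) expR (phip (scons b x)) = 1.
Variables (M : nat -> (nat -> S) -> R) (E : ((nat -> S) -> R) -> R).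
Hypothesis hM : invariant_weights M.
Hypothesis hE : forall f C, var_le theta C f -> forall n,
  `|E f - wsum n (fun y => M n y * f y)| <= C * theta ^+ n.
Implicit Types (x y : nat -> S).
Local Notation P := (transfer phip).

Let M0 := weights_ge0 hM.

Lemma wsum_weights_cvg f C : var_le theta C f ->
  (fun n => wsum n (fun y => M n y * f y)) @ \oo --> E f.
Proof.
move=> fC; apply/cvgrPdist_le => e e0.
have /cvgrPdist_le/(_ _ e0) := geometric_cvg0 C theta01; apply: filterS => n.
rewrite sub0r normrN => h; apply: le_trans (hE fC n) _.
by apply: le_trans h; exact: ler_norm.
Qed.

Lemma gibbs_pressure_ge0 :
  (forall n b y, M n.+1 (scons b y) <=
     expR (phip (scons b y) + Np * theta ^+ n.+1) * M n y) ->
  0 <= entropy_rate M + E phip.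
Proof.
move=> gibbs.
have h n : - E phip - (2 * Np * theta) * theta ^+ n <= cond_entropy M n.
  have step : - (wsum n (fun y => \sum_b M n.+1 (scons b y) *
       (phip (scons b y) + Np * theta ^+ n.+1))) <= cond_entropy M n.
    rewrite lerN2; apply: wsum_le => y; apply: ler_sum => b _.
    have := M0 n.+1 (scons b y); rewrite le_eqVlt => /orP[/eqP <-|h].
      by rewrite !mul0r.
    have h' := lt_le_trans h (weights_scons_le hM n b y).
    rewrite ler_pM2l// lerBlDr -(expRK (_ + _)) -lnM ?posrE ?expR_gt0//.
    by rewrite ler_ln ?posrE ?mulr_gt0 ?expR_gt0.
  apply: le_trans step.
  rewrite -(wsumS n (fun y => M n.+1 y * (phip y + Np * theta ^+ n.+1))).
  have -> : wsum n.+1 (fun y => M n.+1 y * (phip y + Np * theta ^+ n.+1)) =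
      wsum n.+1 (fun y => M n.+1 y * phip y) + Np * theta ^+ n.+1.
    rewrite -[X in _ + X]mulr1 -(wsum_weights hM n.+1) -wsumZ -wsumD.
    by apply: eq_wsum => y; ring.
  have := hE phip_var n.+1; rewrite exprS ler_norml => /andP[+ _].
  by lra.
have hc : (fun n => - E phip - (2 * Np * theta) * theta ^+ n) @ \oo --> - E phip.
  by rewrite -[X in _ --> X]subr0; apply: cvgB; [exact: cvg_cst|exact: geometric_cvg0].
rewrite addrC -lerBlDl sub0r.
have /cvg_lim <- // := hc; apply: ler_lim; last exact: nearW.
- by apply/cvg_ex; eexists; exact: hc.
- by apply/cvg_ex; eexists; exact: (cond_entropy_cvg hM).
Qed.

(* Gibbs' inequality against the tilted conditional weights
   [exp (phip + t f)], whose total mass is at most [1 + t P f + 2 (t F)^2]. *)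
Lemma tilted_gibbs_inequality f F t : (forall x, `|f x| <= F) -> 0 < t -> t * F <= 1 / 2 ->
  0 <= entropy_rate M + E phip -> forall n,
  t * wsum n.+1 (fun y => M n.+1 y * f y) <=
  t * wsum n (fun y => M n y * P f y) + 2 * (t * F) ^+ 2 + Np * theta ^+ n.+1.
Proof.
move=> fF t0 tF hP n.
have F0 : 0 <= F by exact: le_trans (fF (fun=> point)).
have h1 : 0 <= cond_entropy M n + E phip.
  by apply: le_trans hP _; rewrite lerD2r entropy_rate_le.
have := hE phip_var n.+1; rewrite ler_norml => /andP[_ h2].
pose r b y := M n y * expR (phip (scons b y) + t * f (scons b y)).
have h3 b y : M n.+1 (scons b y) - r b y <= M n.+1 (scons b y) *
    (ln (M n.+1 (scons b y)) - ln (M n y) - phip (scons b y) - t * f (scons b y)).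
  have := M0 n y; rewrite le_eqVlt => /orP[/eqP y0|y0].
    have -> : M n.+1 (scons b y) = 0.
      by apply/eqP; rewrite eq_le M0 andbT y0 weights_scons_le.
    by rewrite /r -y0 !mul0r subrr.
  have r0 : 0 < r b y by rewrite mulr_gt0// expR_gt0.
  apply: le_trans (mul_lnB_ge (M0 _ _) (ltW r0) _) _.
    by move=> e; rewrite e ltxx in r0.
  by rewrite /r lnM ?posrE ?expR_gt0// expRK opprD opprD !addrA.
have h4 y : \sum_b r b y <= M n y * (1 + t * P f y + 2 * (t * F) ^+ 2).
  rewrite /r -mulr_sumr ler_wpM2l//.
  have -> : 1 + t * P f y + 2 * (t * F) ^+ 2 =
      \sum_b expR (phip (scons b y)) * (1 + t * f (scons b y) + 2 * (t * F) ^+ 2).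
    rewrite (eq_bigr (fun b => expR (phip (scons b y)) * (1 + 2 * (t * F) ^+ 2) +
        t * (expR (phip (scons b y)) * f (scons b y)))); last by move=> b _; ring.
    by rewrite big_split/= -mulr_suml phip_norm -mulr_sumr -/(transfer phip f y); ring.
  apply: ler_sum => b _; rewrite expRD ler_wpM2l ?expR_ge0//.
  have tf : `|t * f (scons b y)| <= t * F.
    by rewrite normrM gtr0_norm// ler_wpM2l// ltW.
  apply: le_trans (expR_le_quad (le_trans tf tF)) _.
  rewrite lerD2l ler_wpM2l// -real_normK ?num_real//.
  by rewrite lerXn2r ?nnegrE// mulr_ge0// ltW.
have h5 : wsum n (fun y => \sum_b (M n.+1 (scons b y) - r b y)) <=
  wsum n (fun y => \sum_b M n.+1 (scons b y) *
    (ln (M n.+1 (scons b y)) - ln (M n y) - phip (scons b y) - t * f (scons b y))).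
  by apply: wsum_le => y; exact: ler_sum.
have h6 : wsum n (fun y => \sum_b M n.+1 (scons b y) *
    (ln (M n.+1 (scons b y)) - ln (M n y) - phip (scons b y) - t * f (scons b y))) =
    - cond_entropy M n - wsum n.+1 (fun y => M n.+1 y * phip y)
     - t * wsum n.+1 (fun y => M n.+1 y * f y).
  rewrite /cond_entropy opprK -wsumZ !wsumS -!wsumB; apply: eq_wsum => y.
  by rewrite -!sumrB; apply: eq_bigr => b _; ring.
have h7 : - t * wsum n (fun y => M n y * P f y) - 2 * (t * F) ^+ 2 <=
    wsum n (fun y => \sum_b (M n.+1 (scons b y) - r b y)).
  have -> : - t * wsum n (fun y => M n y * P f y) - 2 * (t * F) ^+ 2 =
     wsum n (fun y => M n y - M n y * (1 + t * P f y + 2 * (t * F) ^+ 2)).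
    have e : 2 * (t * F) ^+ 2 = wsum n (fun y => 2 * (t * F) ^+ 2 * M n y).
      by rewrite wsumZ (wsum_weights hM) mulr1.
    rewrite [X in _ - X]e -wsumZ -wsumB.
    by apply: eq_wsum => y; ring.
  by apply: wsum_le => y; rewrite sumrB -weights_scons// lerD2l lerN2 h4.
by rewrite h6 in h5; lra.
Qed.

Lemma equilibrium_transfer_le f C F : 0 <= C -> (forall x, `|f x| <= F) ->
  var_le theta C f -> 0 <= entropy_rate M + E phip -> E f <= E (P f).
Proof.
move=> C0 fF fC hP.
have F0 : 0 <= F by exact: le_trans (fF (fun=> point)).
have PfC := var_le_transfer theta01 Np0 phip_var phip_norm C0 fF fC.
have lim t : 0 < t -> t * F <= 1 / 2 -> t * E f <= t * E (P f) + 2 * (t * F) ^+ 2.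
  move=> t0 tF.
  have c1 : (fun n => t * wsum n.+1 (fun y => M n.+1 y * f y)) @ \oo --> t * E f.
    apply: cvgM; first exact: cvg_cst.
    by have := wsum_weights_cvg fC; rewrite -cvg_shiftS.
  have c2 : (fun n => t * wsum n (fun y => M n y * P f y) + 2 * (t * F) ^+ 2 +
       Np * theta ^+ n.+1) @ \oo --> t * E (P f) + 2 * (t * F) ^+ 2 + 0.
    apply: cvgD; first apply: cvgD; last 1 first.
    - by have := geometric_cvg0 Np theta01; rewrite -cvg_shiftS.
    - by apply: cvgM; [exact: cvg_cst|exact: wsum_weights_cvg PfC].
    - exact: cvg_cst.
  rewrite -[leRHS]addr0 -(cvg_lim _ c1)// -(cvg_lim _ c2)//; apply: ler_lim.
  - by apply/cvg_ex; eexists; exact: c1.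
  - by apply/cvg_ex; eexists; exact: c2.
  - by apply: nearW => n; exact: tilted_gibbs_inequality.
apply/ler_addgt0Pr => e e0.
pose t := Num.min (1 / (2 * (F + 1))) (e / (2 * (F + 1) ^+ 2)).
have F1 : 0 < F + 1 by lra.
have t0 : 0 < t by rewrite lt_min !divr_gt0// mulr_gt0// exprn_gt0.
have tF1 : t * (F + 1) <= 1 / 2.
  apply: (@le_trans _ _ (1 / (2 * (F + 1)) * (F + 1))).
    by rewrite ler_wpM2r ?ge_min ?lexx// ltW.
  by rewrite le_eqVlt; apply/orP; left; apply/eqP; field; rewrite gt_eqF.
have tF2 : t * (2 * (F + 1) ^+ 2) <= e.
  by rewrite -ler_pdivlMr ?ge_min ?lexx ?orbT// mulr_gt0// exprn_gt0.
have tF : t * F <= 1 / 2 by apply: le_trans tF1; rewrite ler_pM2l//; lra.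
rewrite -(ler_pM2l t0) mulrDr; apply: le_trans (lim t t0 tF) _.
rewrite lerD2l; apply: (@le_trans _ _ (t * (t * (2 * (F + 1) ^+ 2)))); last by rewrite ler_pM2l.
have -> : 2 * (t * F) ^+ 2 = t * (t * (2 * F ^+ 2)) by ring.
by rewrite !ler_pM2l// lerXn2r ?nnegrE//; lra.
Qed.

Lemma equilibrium_transfer f C F : 0 <= C -> (forall x, `|f x| <= F) ->
  var_le theta C f -> 0 <= entropy_rate M + E phip -> E (P f) = E f.
Proof.
move=> C0 fF fC hP; apply/eqP; rewrite eq_le (equilibrium_transfer_le C0 fF fC hP) andbT.
pose g x := - f x.
have gC : var_le theta C g by move=> n x y xy; rewrite -opprD normrN; exact: fC.
have gF x : `|g x| <= F by rewrite normrN.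
have PfC := var_le_transfer theta01 Np0 phip_var phip_norm C0 fF fC.
have EN h D : var_le theta D h -> E (fun x => - h x) = - E h.
  move=> hD; have nD : var_le theta D (fun x => - h x).
    by move=> n x y xy; rewrite -opprD normrN; exact: hD.
  have c1 := wsum_weights_cvg nD; have c2 := wsum_weights_cvg hD.
  have c3 : (fun n => wsum n (fun y => M n y * - h y)) @ \oo --> - E h.
    rewrite (_ : (fun n => _) = fun n => - wsum n (fun y => M n y * h y)).
      exact: cvgN.
    by apply/funext => n; rewrite -wsumN; apply: eq_wsum => y; rewrite mulrN.
  by rewrite -(cvg_lim _ c1)//; exact: cvg_lim c3.
have := equilibrium_transfer_le C0 gF gC hP; rewrite (EN f C)//.
have -> : P g = fun x => - P f x.
  by apply/funext => x; rewrite /transfer -sumrN; apply: eq_bigr => b _; rewrite mulrN.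
by rewrite (EN _ _ PfC) lerN2.
Qed.

End Variational.

(** * Cylinder masses of a shift-invariant probability *)

Section Cylinders.
Variables (S : finPointedType).
Implicit Types (x y : nat -> S).

Definition pcyl n y : set (seqspace S) := [set x | agree n x y].

Lemma pcylE n y : pcyl n y = cyl (fun i : 'I_n => y i).
Proof.
apply/seteqP; split => x /= h; first by move=> i; exact: h.
by move=> i lt_in; exact: (h (Ordinal lt_in)).
Qed.

Lemma measurable_pcyl n y : measurable (pcyl n y).
Proof. by apply: sub_sigma_algebra; exists n, (fun i => y i); exact: pcylE. Qed.

Lemma pcyl_agree n x y : agree n x y -> pcyl n x = pcyl n y.
Proof.
move=> xy; apply/seteqP; split => u /= h; first exact: agree_trans h xy.
exact: agree_trans h (agree_sym xy).
Qed.

Lemma pcyl_snoc n y : pcyl n y = \bigcup_(c in [set: S]) pcyl n.+1 (snoc n y c).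
Proof.
apply/seteqP; split => [x xy|x [c _] xy].
  exists (x n) => // i; rewrite ltnS leq_eqVlt /snoc => /orP[/eqP ->|lt_in].
    by rewrite eqxx.
  by rewrite ltn_eqF// xy.
move=> i lt_in; rewrite (xy i (leqW lt_in)); exact: agree_snoc.
Qed.

Lemma shift_pcyl n y :
  @Defs.shift S @^-1` pcyl n y = \bigcup_(b in [set: S]) pcyl n.+1 (scons b y).
Proof.
apply/seteqP; split => [x xy|x [b _] xy].
  by exists (x 0%N) => // -[|i]//= lt_in; exact: xy.
by move=> i lt_in; exact: (xy i.+1).
Qed.

Lemma trivIset_snoc n y : trivIset setT (fun c => pcyl n.+1 (snoc n y c)).
Proof.
move=> c c' _ _ [x [h1 h2]].
by have := h1 n (ltnSn n); have := h2 n (ltnSn n); rewrite /snoc eqxx => <-.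
Qed.

Lemma trivIset_scons n y : trivIset setT (fun b => pcyl n.+1 (scons b y)).
Proof. by move=> c c' _ _ [x [/(_ 0%N isT) /= <- /(_ 0%N isT) /= ->]]. Qed.

Definition wext n (w : 'I_n -> S) : nat -> S :=
  fun i => if insub i is Some j then w j else point.

Lemma cyl_pcyl n (w : 'I_n -> S) : cyl w = pcyl n (wext w).
Proof. by rewrite pcylE; congr cyl; apply/funext => i; rewrite /wext valK. Qed.

Lemma sum_ffun_wsum (R : realType) n (F : (nat -> S) -> R) :
  \sum_(w : {ffun 'I_n -> S}) F (wext w) = wsum n F.
Proof.
elim: n F => [|n IH] F.
  rewrite /= (bigD1 [ffun=> point])//= big1 => [|w]; last first.
    by move=> /eqP[]; apply/ffunP => -[].
  rewrite addr0; congr F; apply/funext => i; rewrite /wext.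
  by case: insubP => // -[].
pose h (p : S * {ffun 'I_n -> S}) : {ffun 'I_n.+1 -> S} :=
  [ffun i => if unlift ord0 i is Some j then p.2 j else p.1].
pose h' (w : {ffun 'I_n.+1 -> S}) : S * {ffun 'I_n -> S} :=
  (w ord0, [ffun j => w (lift ord0 j)]).
have hK : cancel h h'.
  move=> [b w]; rewrite /h /h'; congr pair; first by rewrite ffunE unlift_none.
  by apply/ffunP => j; rewrite !ffunE liftK.
have h'K : cancel h' h.
  move=> w; apply/ffunP => i; rewrite !ffunE; case: unliftP => [j ->|->] //=.
  by rewrite ffunE.
rewrite (reindex h) /=; last by apply: onW_bij; exists h'.
rewrite -(pair_bigA _ (fun b w => F (wext (h (b, w))))) /=; apply: eq_bigr => b _.
rewrite -IH; apply: eq_bigr => w _; congr F; apply/funext => -[|i] /=.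
  rewrite /wext; case: insubP => // j _ j0; rewrite ffunE.
  by have -> : j = ord0 by [apply/val_inj]; rewrite unlift_none.
rewrite /wext; case: insubP => [j lt_in ji|].
  rewrite ltnS in lt_in.
  rewrite ffunE (_ : j = lift ord0 (Ordinal lt_in)) ?liftK/=; last exact/val_inj.
  by rewrite insubT.
by rewrite ltnS; case: insubP => // j ->.
Qed.

End Cylinders.

Section MeasureWeights.
Variables (R : realType) (S : finPointedType) (mu : probability (seqspace S) R).
Implicit Types (x y : nat -> S).

Definition cyl_mass n y : R := fine (mu (pcyl n y)).

Lemma cyl_massE n y : mu (pcyl n y) = (cyl_mass n y)%:E.
Proof. by rewrite fineK// fin_num_measure//; exact: measurable_pcyl. Qed.

Lemma probability_bigcup_letters (A : S -> set (seqspace S)) (F : S -> R) :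
  (forall b, measurable (A b)) -> trivIset setT A ->
  (forall b, mu (A b) = (F b)%:E) ->
  mu (\bigcup_(b in [set: S]) A b) = (\sum_b F b)%:E.
Proof.
move=> mA tA AF; rewrite measure_fin_bigcup//; last exact: finite_finset.
have -> : [set: S] = [set` index_enum S].
  by apply/seteqP; split => b //= _; rewrite mem_index_enum.
rewrite -fsbig_seq ?index_enum_uniq// -sumEFin.
by apply: eq_bigr => b _; exact: AF.
Qed.

Lemma cyl_mass_weights : shift_invariant mu -> invariant_weights cyl_mass.
Proof.
move=> inv; split.
- by move=> n y; rewrite fine_ge0.
- by move=> n x y xy; rewrite /cyl_mass (pcyl_agree xy).
- move=> y; rewrite /cyl_mass (_ : pcyl 0%N y = setT) ?probability_setT//.
  by apply/seteqP; split.
- move=> n y; rewrite /cyl_mass pcyl_snoc.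
  rewrite (@probability_bigcup_letters _ (fun c => cyl_mass n.+1 (snoc n y c)))//.
  + by move=> b; exact: measurable_pcyl.
  + exact: trivIset_snoc.
  + by move=> b; exact: cyl_massE.
- move=> n y; rewrite /cyl_mass -inv ?shift_pcyl//; last exact: measurable_pcyl.
  rewrite (@probability_bigcup_letters _ (fun b => cyl_mass n.+1 (scons b y)))//.
  + by move=> b; exact: measurable_pcyl.
  + exact: trivIset_scons.
  + by move=> b; exact: cyl_massE.
Qed.

Lemma cyl_entropyE n : cyl_entropy mu n = word_entropy cyl_mass n.
Proof.
rewrite /cyl_entropy /word_entropy -sum_ffun_wsum; congr (- _).
by apply: eq_bigr => w _; rewrite /cyl_mass cyl_pcyl.
Qed.

Lemma ks_entropyE : shift_invariant mu -> ks_entropy mu = entropy_rate cyl_mass.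
Proof.
move=> inv; apply/cvg_lim => //.
have := word_entropy_mean_cvg (cyl_mass_weights inv).
by under eq_fun do rewrite -cyl_entropyE.
Qed.

Definition trunc n x : nat -> S := fun i => if (i < n)%N then x i else point.

Lemma agree_trunc n x : agree n x (trunc n x).
Proof. by move=> i lt_in; rewrite /trunc lt_in. Qed.

Lemma trunc_wsum n (f : (nat -> S) -> R) x :
  f (trunc n x) = wsum n (fun y => f y * \1_(pcyl n y) x).
Proof.
elim: n f x => [|n IH] f x /=.
  rewrite indicE mem_set ?mulr1; last exact: agree0.
  by congr f; apply/funext.
rewrite (bigD1 (x 0%N))//= big1 ?addr0 => [|b bx].
  rewrite (_ : trunc n.+1 x = scons (x 0%N) (trunc n (Defs.shift x))); last first.
    by apply/funext => -[|i].
  rewrite (IH (fun y => f (scons (x 0%N) y))); apply: eq_wsum => y.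
  congr (_ * _); rewrite !indicE; congr (_%:R : R); congr nat_of_bool.
  apply/idP/idP; rewrite !inE => h; first by move=> [|i] //= /h.
  by move=> i lt_in; exact: (h i.+1).
rewrite -[RHS](mul0r (wsum n (fun _ : nat -> S => 0 : R))) -wsumZ; apply: eq_wsum => y.
rewrite mul0r indicE memNset ?mulr0// => /(_ 0%N isT) /= e.
by rewrite e eqxx in bx.
Qed.

Lemma wsum_measurable n (F : (nat -> S) -> seqspace S -> R) :
  (forall y, measurable_fun setT (F y)) ->
  measurable_fun setT (fun x : seqspace S => wsum n (fun y => F y x)).
Proof.
elim: n F => [|n IH] F mF /=; first exact: mF.
by apply: measurable_sum => b; exact: IH.
Qed.

Lemma measurable_trunc n (f : (nat -> S) -> R) :
  measurable_fun setT (fun x : seqspace S => f (trunc n x)).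
Proof.
rewrite (_ : (fun x => _) = fun x : seqspace S => wsum n (fun y => f y * \1_(pcyl n y) x)).
  2: by apply/funext => x; exact: trunc_wsum.
apply: wsum_measurable => y; apply: measurable_funM; first exact: measurable_cst.
by apply: measurable_indic; exact: measurable_pcyl.
Qed.

Section VarLe.
Variables (theta C : R) (f : (nat -> S) -> R).
Hypothesis theta01 : 0 < theta < 1.
Hypothesis fC : var_le theta C f.

Lemma var_le_measurable : measurable_fun setT (fun x : seqspace S => f x).
Proof.
apply: (@measurable_fun_cvg _ _ _ _ (fun n (x : seqspace S) => f (trunc n x))) => [n|x _].
  exact: measurable_trunc.
apply/cvgrPdist_le => e e0.
have /cvgrPdist_le/(_ _ e0) := geometric_cvg0 C theta01; apply: filterS => n.
rewrite sub0r normrN => h; apply: le_trans (fC (agree_trunc x)) _.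
by apply: le_trans h; exact: ler_norm.
Qed.

Lemma var_le_integrable : mu.-integrable setT (EFin \o f).
Proof.
apply: measurable_bounded_integrable => //.
- by apply: le_lt_trans (probability_le1 mu measurableT) _; exact: ltry.
- exact: var_le_measurable.
- exists (`|f (fun=> point)| + C); split; first exact: num_real.
  move=> M CM x _ /=; apply: le_trans (ltW CM).
  rewrite -[f x](subrK (f (fun=> point))) addrC.
  apply: le_trans (ler_normD _ _) _; rewrite lerD2l.
  by have := fC (@agree0 _ x (fun=> point)); rewrite expr0 mulr1.
Qed.

End VarLe.

Lemma expectD (f g : seqspace S -> R) :
  mu.-integrable setT (EFin \o f) -> mu.-integrable setT (EFin \o g) ->
  mu.-integrable setT (EFin \o (fun x => f x + g x)) /\
  expect mu (fun x => f x + g x) = expect mu f + expect mu g.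
Proof.
by move=> mf mg; split; [exact: (integrableD _ mf mg)|exact: RintegralD].
Qed.

Lemma expect_cst c : mu.-integrable setT (EFin \o (fun=> c)) /\
  expect mu (fun=> c) = c.
Proof.
split; first exact: finite_measure_integrable_cst.
rewrite /expect integral_cst// -[RHS]mulr1 -[RHS]/(fine (c%:E * 1%:E)%E).
by congr (fine (_ * _)%E); exact: probability_setT.
Qed.

Lemma expect_sum (I : Type) (r : seq I) (F : I -> seqspace S -> R) :
  (forall i, mu.-integrable setT (EFin \o F i)) ->
  mu.-integrable setT (EFin \o (fun x => \sum_(i <- r) F i x)) /\
  expect mu (fun x => \sum_(i <- r) F i x) = \sum_(i <- r) expect mu (F i).
Proof.
move=> mF; elim: r => [|i r [IH1 IH2]].
  rewrite big_nil (_ : (fun x => _) = fun _ : seqspace S => 0); first exact: expect_cst.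
  by apply/funext => x; rewrite big_nil.
rewrite big_cons -IH2.
rewrite (_ : (fun x => _) = fun x : seqspace S => F i x + \sum_(j <- r) F j x).
  exact: expectD.
by apply/funext => x; rewrite big_cons.
Qed.

Lemma expect_wsum n (F : (nat -> S) -> seqspace S -> R) :
  (forall y, mu.-integrable setT (EFin \o F y)) ->
  mu.-integrable setT (EFin \o (fun x => wsum n (fun y => F y x))) /\
  expect mu (fun x => wsum n (fun y => F y x)) = wsum n (fun y => expect mu (F y)).
Proof.
elim: n F => [|n IH] F mF; first by split => //; exact: mF.
have H b := IH (fun y => F (scons b y)) (fun y => mF _).
have [h1 h2] := expect_sum (index_enum S) (fun b => (H b).1).
by split; [exact: h1|rewrite h2 /=; apply: eq_bigr => b _; exact: (H b).2].
Qed.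

Lemma expect_trunc n (f : (nat -> S) -> R) :
  mu.-integrable setT (EFin \o (fun x : seqspace S => f (trunc n x))) /\
  expect mu (fun x => f (trunc n x)) = wsum n (fun y => cyl_mass n y * f y).
Proof.
have mi y : mu.-integrable setT (EFin \o (\1_(pcyl n y) : seqspace S -> R)).
  by apply: integrable_indic => //; exact: measurable_pcyl.
have mF y : mu.-integrable setT (EFin \o (fun x : seqspace S => f y * \1_(pcyl n y) x)).
  exact: (integrableZl _ _ (mi y)).
rewrite (_ : (fun x => _) = fun x => wsum n (fun y => f y * \1_(pcyl n y) x)).
  have [h1 ->] := expect_wsum n mF; split => //; apply: eq_wsum => y.
  rewrite mulrC.
  transitivity (f y * expect mu (\1_(pcyl n y))); first exact: RintegralZl.
  by congr (_ * _); rewrite /expect integral_indic ?setIT//; exact: measurable_pcyl.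
by apply/funext => x; rewrite trunc_wsum.
Qed.

Lemma expect_approx theta C f : 0 < theta < 1 -> var_le theta C f -> forall n,
  `|expect mu f - wsum n (fun y => cyl_mass n y * f y)| <= C * theta ^+ n.
Proof.
move=> t01 fC n; rewrite -(expect_trunc n f).2.
have mf := var_le_integrable t01 fC; have mt := (expect_trunc n f).1.
have [mc ec] := expect_cst (C * theta ^+ n).
have [m1 e1] := expectD mt mc; have [m2 e2] := expectD mf mc.
have ft x : `|f x - f (trunc n x)| <= C * theta ^+ n by exact: fC (agree_trunc x).
have h1 : expect mu f <= expect mu (fun x => f (trunc n x) + C * theta ^+ n).
  apply: le_Rintegral => // x _; have := ft x; rewrite ler_norml => /andP[_]; lra.
have h2 : expect mu (fun x => f (trunc n x)) <= expect mu (fun x => f x + C * theta ^+ n).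
  apply: le_Rintegral => // x _; have := ft x; rewrite ler_norml => /andP[+ _]; lra.
by rewrite ler_norml; rewrite e1 ec in h1; rewrite e2 ec in h2; lra.
Qed.

End MeasureWeights.

(** * Realization of invariant weights by a probability *)

Section Partition.
Variables (R : realType) (S : finPointedType) (m : S -> R).
Hypothesis m0 : forall c, 0 <= m c.

Definition below j : R := \sum_(c | (enum_rank c < j)%N) m c.

Lemma belowS (c : S) : below (enum_rank c).+1 = below (enum_rank c) + m c.
Proof.
rewrite /below (bigD1 c)//= addrC; congr (_ + _); apply: eq_bigl => c'.
rewrite ltnS ltn_neqAle andbC; congr (_ && _).
by apply/idP/idP; apply: contra => /eqP; [move/val_inj/enum_rank_inj|] => ->.
Qed.

Lemma below_le j k : (j <= k)%N -> below j <= below k.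
Proof.
move=> jk; rewrite /below [leRHS](bigID (fun c : S => (enum_rank c < j)%N))/=.
rewrite [X in _ <= X + _](eq_bigl (fun c : S => (enum_rank c < j)%N)); last first.
  by move=> c; apply/andP/idP => [[]//|cj]; split => //; exact: leq_trans jk.
by rewrite lerDl sumr_ge0.
Qed.

Lemma below_ge0 j : 0 <= below j.
Proof. exact: sumr_ge0. Qed.

Lemma below_card : below #|S| = \sum_c m c.
Proof. by apply: eq_bigl => c; rewrite ltn_ord. Qed.

Lemma below_le_sum c : below (enum_rank c) + m c <= \sum_c m c.
Proof. by rewrite -belowS -below_card below_le. Qed.

Lemma below_exists v : 0 <= v < \sum_c m c ->
  exists c, below (enum_rank c) <= v < below (enum_rank c) + m c.
Proof.
rewrite -below_card => /andP[v0 v1].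
have ex : exists j, (v < below j) by exists #|S|.
have below0 : below 0 = 0 by rewrite /below big1.
case: (ex_minnP ex) => -[|j]; first by rewrite below0 ltNge v0.
move=> vj min; have jS : (j < #|S|)%N by have := min _ v1.
exists (enum_val (Ordinal jS)); rewrite -belowS enum_valK /= vj andbT.
by rewrite leNgt; apply/negP => /min; rewrite ltnn.
Qed.

Lemma below_uniq v c c' : below (enum_rank c) <= v < below (enum_rank c) + m c ->
  below (enum_rank c') <= v < below (enum_rank c') + m c' -> c = c'.
Proof.
wlog cc' : c c' / (enum_rank c <= enum_rank c')%N.
  move=> H h h'; have [cc'|/ltnW cc'] := leqP (enum_rank c) (enum_rank c').
    exact: H.
  by apply/esym/H.
move=> /andP[_ h] /andP[h' _]; move: cc'; rewrite leq_eqVlt => /orP[/eqP/val_inj/enum_rank_inj//|].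
by move=> /below_le; rewrite belowS => /(lt_le_trans h)/lt_le_trans/(_ h'); rewrite ltxx.
Qed.

End Partition.

Section Coding.
Variables (R : realType) (S : finPointedType) (M : nat -> (nat -> S) -> R).
Hypothesis hM : invariant_weights M.
Implicit Types (x y : nat -> S) (u : R).

Let M0 := weights_ge0 hM.

Fixpoint left_end n y : R :=
  if n is k.+1 then
    left_end k y + below (fun c => M n (snoc k y c)) (enum_rank (y k))
  else 0.

Definition cell n y : set R := [set u | left_end n y <= u < left_end n y + M n y].

Lemma snoc_agree n x y c : agree n x y -> agree n.+1 (snoc n x c) (snoc n y c).
Proof.
move=> xy i; rewrite ltnS leq_eqVlt /snoc => /orP[/eqP ->|lt_in].
  by rewrite eqxx.
by rewrite ltn_eqF// xy.
Qed.

Lemma snoc_last n y : agree n.+1 (snoc n y (y n)) y.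
Proof. by move=> i _; rewrite /snoc; case: eqP => // ->. Qed.

Lemma left_end_agree n x y : agree n x y -> left_end n x = left_end n y.
Proof.
elim: n => [//|n IH] xy /=.
have xy' : agree n x y by move=> i lt_in; apply: xy; exact: ltnW.
rewrite IH// xy//; congr (_ + below _ _); apply/funext => c.
exact/(weights_agree hM)/snoc_agree.
Qed.

Lemma cell_agree n x y : agree n x y -> cell n x = cell n y.
Proof. by move=> xy; rewrite /cell (left_end_agree xy) (weights_agree hM xy). Qed.

Lemma cell_snoc n y c u : cell n.+1 (snoc n y c) u <->
  below (fun c => M n.+1 (snoc n y c)) (enum_rank c) <= u - left_end n y <
  below (fun c => M n.+1 (snoc n y c)) (enum_rank c) + M n.+1 (snoc n y c).
Proof.
rewrite /cell /= (left_end_agree (@agree_snoc _ n y c)).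
rewrite (_ : snoc n y c n = c); last by rewrite /snoc eqxx.
rewrite (_ : (fun c0 => _) = fun c => M n.+1 (snoc n y c)); last first.
  by apply/funext => c'; apply: (weights_agree hM); apply: snoc_agree; exact: agree_snoc.
by rewrite lerBrDl ltrBlDl addrA.
Qed.

Lemma cell_exists n y u : cell n y u -> exists c, cell n.+1 (snoc n y c) u.
Proof.
move=> /= /andP[h1 h2].
have [|c hc] := @below_exists R S (fun c => M n.+1 (snoc n y c)) (u - left_end n y).
  by rewrite -(weights_snoc hM) subr_ge0 h1 ltrBlDl.
by exists c; exact/cell_snoc.
Qed.

Lemma cell_uniq n y u c c' :
  cell n.+1 (snoc n y c) u -> cell n.+1 (snoc n y c') u -> c = c'.
Proof. by move=> /cell_snoc h /cell_snoc; apply: below_uniq h. Qed.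

Lemma cell_sub n y : cell n.+1 y `<=` cell n y.
Proof.
move=> u; rewrite -(cell_agree (@snoc_last n y)) => /cell_snoc/andP[h1 h2].
have b0 := @below_ge0 _ _ _ (fun c => M0 n.+1 (snoc n y c)) (enum_rank (y n)).
have := @below_le_sum _ _ _ (fun c => M0 n.+1 (snoc n y c)) (y n).
rewrite -(weights_snoc hM) => h3; rewrite /cell /=; apply/andP; split; lra.
Qed.

Lemma cell0 y : cell 0%N y = `[0, 1[%classic.
Proof. by rewrite /cell /= (weights0 hM) add0r set_itvco. Qed.

Lemma cell_sub01 n y : cell n y `<=` `[0, 1[%classic.
Proof.
elim: n => [|n IH]; first by rewrite cell0.
by apply: subset_trans IH; exact: cell_sub.
Qed.

Fixpoint code_prefix u n : nat -> S :=
  if n is k.+1 then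
    snoc k (code_prefix u k)
      (odflt point [pick c | `[< cell n (snoc k (code_prefix u k) c) u >]])
  else fun=> point.

Definition code u : nat -> S := fun i => code_prefix u i.+1 i.

Lemma code_agree u n : agree n (code u) (code_prefix u n).
Proof.
elim: n => [//|n IH] i; rewrite ltnS leq_eqVlt => /orP[/eqP ->//|lt_in].
by rewrite /= /snoc (ltn_eqF lt_in) IH.
Qed.

Lemma cell_code u n : `[0, 1[%classic u -> cell n (code_prefix u n) u.
Proof.
move=> u01; elim: n => [|n IH]; first by rewrite cell0.
have [c hc] := cell_exists IH; rewrite [code_prefix _ _]/=; case: pickP => [c' /asboolP//|].
by move=> /(_ c); rewrite asboolT.
Qed.

Lemma codeP u n y : `[0, 1[%classic u -> cell n y u <-> agree n (code u) y.
Proof.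
move=> u01; split => [|h]; last first.
  by rewrite -(cell_agree (agree_trans (agree_sym (@code_agree u n)) h)); exact: cell_code.
elim: n => [//|n IH] yu.
have h := IH (cell_sub yu).
have h' := agree_trans (agree_sym (@code_agree u n)) h.
move=> i; rewrite ltnS leq_eqVlt => /orP[/eqP -> {i}|]; last exact: h.
have := @cell_code u n.+1 u01; rewrite -(cell_agree (@code_agree u n.+1)).
rewrite -(cell_agree (@snoc_last n (code u))) (cell_agree (snoc_agree _ h)).
rewrite -(cell_agree (@snoc_last n y)) in yu.
by move/cell_uniq; apply.
Qed.

Lemma code_out u : ~ `[0, 1[%classic u -> code u = fun=> point.
Proof.
move=> u01; apply/funext => i; rewrite /code /= /snoc eqxx.
by case: pickP => // c /asboolP /cell_sub01.
Qed.

Definition code_seq : measurableTypeR R -> seqspace S := code.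

Lemma measurable_cell n y : measurable (cell n y : set (measurableTypeR R)).
Proof. by rewrite /cell -set_itvco; exact: measurable_itv. Qed.

Lemma measurable_code : measurable_fun setT code_seq.
Proof.
apply: (@measurability _ _ (measurableTypeR R) (seqspace S) setT code_seq (@cylinders S) erefl).
move=> _ [_ [n [w ->]] <-]; rewrite setTI.
rewrite cyl_pcyl; move: (wext w) => y.
have [hp|hp] := pselect (agree n (fun=> point : S) y).
  rewrite (_ : _ @^-1` _ = cell n y `|` ~` `[0, 1[%classic).
    apply: measurableU; first exact: measurable_cell.
    by apply: measurableC; exact: measurable_itv.
  apply/seteqP; split => u /=.
    have [u01|u01] := pselect (`[0, 1[%classic u); last by right.
    by move=> /(codeP _ _ u01); left.
  move=> [h|/code_out h]; last by rewrite /pcyl /= /code_seq h.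
  by apply/codeP => //; exact: cell_sub01 h.
rewrite (_ : _ @^-1` _ = cell n y); first exact: measurable_cell.
apply/seteqP; split => u /=; last by move=> h; apply/codeP => //; exact: cell_sub01 h.
have [u01|/code_out u01] := pselect (`[0, 1[%classic u); first by move=> /(codeP _ _ u01).
by rewrite /pcyl /= /code_seq u01.
Qed.

Let m01 : measurable (`[0, 1[%classic : set (measurableTypeR R)).
Proof. exact: measurable_itv. Qed.

Let leb01 := mrestr (@lebesgue_measure R) m01.

Let leb01T : leb01 setT = 1%E.
Proof.
by rewrite /leb01 /mrestr setTI lebesgue_measure_itv/= lte_fin ltr01 oppr0 adde0.
Qed.

HB.instance Definition _ := Measure.on leb01.
HB.instance Definition _ := Measure_isProbability.Build _ _ _ leb01 leb01T.
HB.instance Definition _ := isMeasurableFun.Build _ _ _ _ code_seq measurable_code.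

Lemma weights_probability : exists nu : probability (seqspace S) R,
  forall n y, nu (pcyl n y) = (M n y)%:E.
Proof.
exists (distribution leb01 code_seq) => n y.
transitivity (lebesgue_measure (cell n y)).
  transitivity (lebesgue_measure (code_seq @^-1` pcyl n y `&` `[0, 1[%classic)).
    by [].
  congr lebesgue_measure; apply/seteqP; split => u /=; first by move=> [h u01]; apply/codeP.
  move=> h; have u01 := cell_sub01 h; split => //.
  by move/(codeP _ _ u01): h.
rewrite /cell -set_itvco lebesgue_measure_itv/= lte_fin ltrDl.
have := M0 n y; rewrite le_eqVlt => /orP[/eqP <-|->]; first by rewrite ltxx.
by rewrite -EFinB addrAC subrr add0r.
Qed.

End Coding.

Section Invariance.
Variables (R : realType) (S : finPointedType).
Variables (M : nat -> (nat -> S) -> R) (nu : probability (seqspace S) R).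
Hypothesis hM : invariant_weights M.
Hypothesis nuM : forall n y, nu (pcyl n y) = (M n y)%:E.

Let shiftf : seqspace S -> seqspace S := @Defs.shift S.

Lemma measurable_shift : measurable_fun setT shiftf.
Proof.
apply: (@measurability _ _ (seqspace S) (seqspace S) setT shiftf (@cylinders S) erefl).
move=> _ [_ [n [w ->]] <-]; rewrite setTI.
rewrite cyl_pcyl; move: (wext w) => y.
rewrite shift_pcyl; apply: fin_bigcup_measurable => // b _; exact: measurable_pcyl.
Qed.

HB.instance Definition _ := isMeasurableFun.Build _ _ _ _ shiftf measurable_shift.

Lemma weights_shift_invariant : shift_invariant nu.
Proof.
move=> A mA; pose G : set (set (seqspace S)) := [set B | B = set0 \/ exists n y, B = pcyl n y].
have GC : @measurable _ (seqspace S) = <<s G >>.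
  apply/seteqP; split; apply: smallest_sub.
  - exact: smallest_sigma_algebra.
  - move=> _ [n [w ->]]; apply: sub_sigma_algebra; right.
    by exists n, (wext w); exact: cyl_pcyl.
  - exact: (smallest_sigma_algebra _ (@cylinders S)).
  - by move=> _ [->|[n [y ->]]]; [exact: measurable0|exact: measurable_pcyl].
apply: (measure_unique G (fun=> setT) GC _ _ _ (distribution nu shiftf) nu) => //.
- move=> B C [->|[n [y ->]]] [->|[k [z ->]]]; rewrite ?set0I ?setI0; try by left.
  have [h|] := pselect (exists x, (pcyl n y `&` pcyl k z) x); last first.
    by move=> h; left; apply/seteqP; split => // x hx; apply: h; exists x.
  case: h => x [xy xz]; right; exists (maxn n k), x.
  apply/seteqP; split => t /= => [[ty tz] i|tx].
    rewrite leq_max => /orP[lt_in|lt_ik]; first by rewrite ty// xy.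
    by rewrite tz// xz.
  split => i lt_i; rewrite tx ?leq_max ?lt_i ?orbT//; [exact: xy|exact: xz].
- by move=> _; right; exists 0%N, (fun=> point); apply/seteqP; split.
- by rewrite bigcup_const.
- move=> _ [->|[n [y ->]]]; first by rewrite !measure0.
  suff e : nu (@Defs.shift S @^-1` pcyl n y) = nu (pcyl n y) by exact: e.
  rewrite shift_pcyl nuM (weights_scons hM).
  apply: probability_bigcup_letters => [b||b].
  + exact: measurable_pcyl.
  + exact: trivIset_scons.
  + exact: nuM.
- by move=> _; apply: le_lt_trans (probability_le1 _ measurableT) _; exact: ltry.
Qed.

End Invariance.

(** * The Gibbs measure and the equilibrium state *)

Section GibbsWeights.
Variables (R : realType) (S : finPointedType) (theta Np K rho : R).
Variable phip : (nat -> S) -> R.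
Hypothesis theta01 : 0 < theta < 1.
Hypothesis Np0 : 0 <= Np.
Hypothesis phip_var : var_le theta Np phip.
Hypothesis phip_norm : forall x, \sum_(b : S) expR (phip (scons b x)) = 1.
Local Notation P := (transfer phip).
Hypothesis rho01 : 0 <= rho < 1.
Hypothesis decay : forall f C, var_le theta C f -> 0 <= C ->
  forall n x y, `|iter n P f x - iter n P f y| <= C * K * rho ^+ n.
Implicit Types (x y : nat -> S) (f g : (nat -> S) -> R).

Definition gibbs f : R := limn (fun k => iter k P f (fun=> point)).

Lemma gibbs_cvg f C : var_le theta C f -> 0 <= C ->
  (fun k => iter k P f (fun=> point)) @ \oo --> gibbs f.
Proof.
move=> fC C0; apply: cauchy_cvg; apply: cauchy_exP => e e0.
have : (fun n => C * K * rho ^+ n) @ \oo --> (0 : R).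
  rewrite -(mulr0 (C * K)); apply: cvgM; first exact: cvg_cst.
  by apply: cvg_expr; case/andP: rho01 => ? ?; rewrite ger0_norm.
move/cvgrPdist_lt => /(_ _ e0)[n _ hn].
have := hn n (leqnn n); rewrite /= sub0r normrN => hne.
exists (iter n P f (fun=> point)); exists n => // k /= nk.
rewrite -ball_normE /ball_ /= distrC -(subnKC nk).
apply: le_lt_trans (le_lt_trans (ler_norm _) hne).
by apply: (iter_transfer_osc phip_norm) => x y; exact: decay.
Qed.

Lemma gibbs_unique f l :
  (fun k => iter k P f (fun=> point)) @ \oo --> l -> gibbs f = l.
Proof. by move=> h; exact: cvg_lim. Qed.

Lemma gibbs_le f g C D : var_le theta C f -> 0 <= C -> var_le theta D g -> 0 <= D ->
  (forall x, f x <= g x) -> gibbs f <= gibbs g.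
Proof.
move=> fC C0 gD D0 fg; apply: ler_lim.
- by apply/cvg_ex; eexists; exact: gibbs_cvg fC C0.
- by apply/cvg_ex; eexists; exact: gibbs_cvg gD D0.
- apply: nearW => k; move: (fun=> point); elim: k => [|k IH] x /=; first exact: fg.
  exact: transfer_le.
Qed.

Lemma gibbs_cst c : gibbs (fun=> c) = c.
Proof.
apply: gibbs_unique; rewrite (_ : (fun k => _) = fun=> c); first exact: cvg_cst.
apply/funext => k; suff -> : iter k P (fun=> c) = fun=> c by [].
by elim: k => //= k ->; exact: transfer_cst.
Qed.

Lemma gibbs_scale c f C : var_le theta C f -> 0 <= C ->
  gibbs (fun x => c * f x) = c * gibbs f.
Proof.
move=> fC C0; apply: gibbs_unique.
rewrite (_ : (fun k => _) = fun k => c * iter k P f (fun=> point)).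
  by apply: cvgM; [exact: cvg_cst|exact: gibbs_cvg fC C0].
apply/funext => k; suff -> : iter k P (fun x => c * f x) = fun x => c * iter k P f x by [].
elim: k => //= k ->; apply/funext => x; rewrite /transfer mulr_sumr.
by apply: eq_bigr => b _; rewrite mulrCA.
Qed.

Lemma gibbs_sum (f : S -> (nat -> S) -> R) C : (forall b, var_le theta C (f b)) ->
  0 <= C -> gibbs (fun x => \sum_b f b x) = \sum_b gibbs (f b).
Proof.
move=> fC C0; apply: gibbs_unique.
rewrite (_ : (fun k => _) = fun k => \sum_b iter k P (f b) (fun=> point)).
  by apply: cvg_big => [|b _]; [exact: add_continuous|exact: gibbs_cvg (fC b) C0].
apply/funext => k.
suff -> : iter k P (fun x => \sum_b f b x) = fun x => \sum_b iter k P (f b) x by [].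
elim: k => //= k ->; apply/funext => x; rewrite /transfer exchange_big/=.
by apply: eq_bigr => b _; rewrite mulr_sumr.
Qed.

Lemma gibbs_transfer f C : var_le theta C f -> 0 <= C -> gibbs (P f) = gibbs f.
Proof.
move=> fC C0; apply: gibbs_unique.
rewrite (_ : (fun k => _) = fun k => iter k.+1 P f (fun=> point)).
  by have := gibbs_cvg fC C0; rewrite -cvg_shiftS.
by apply/funext => k; rewrite iterSr.
Qed.

Definition cyl_ind n y : (nat -> S) -> R := fun x => \1_(pcyl n y) x.

Lemma cyl_indE n y x : agree n x y -> cyl_ind n y x = 1.
Proof. by move=> h; rewrite /cyl_ind indicE mem_set. Qed.

Lemma cyl_indN n y x : ~ agree n x y -> cyl_ind n y x = 0.
Proof. by move=> h; rewrite /cyl_ind indicE memNset. Qed.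

Lemma cyl_ind_01 n y x : 0 <= cyl_ind n y x <= 1.
Proof. by rewrite /cyl_ind indicE; case: (_ \in _); rewrite ?lexx ?ler01. Qed.

Lemma var_le_cyl_ind n y : var_le theta (theta ^- n) (cyl_ind n y).
Proof.
have /andP[t0 t1] := theta01.
move=> k x x' xx'; have [nk|kn] := leqP n k.
  have -> : cyl_ind n y x = cyl_ind n y x'.
    have xn : agree n x x' by move=> i lt_in; apply: xx'; exact: leq_trans nk.
    have [h|h] := pselect (agree n x' y).
      by rewrite !cyl_indE//; exact: agree_trans xn h.
    by rewrite !cyl_indN// => h'; apply: h; exact: agree_trans (agree_sym xn) h'.
  by rewrite subrr normr0 mulr_ge0 ?invr_ge0// exprn_ge0// ltW.
apply: (@le_trans _ _ 1).
  have /andP[? ?] := cyl_ind_01 n y x; have /andP[? ?] := cyl_ind_01 n y x'.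
  by rewrite ler_norml; lra.
rewrite mulrC ler_pdivlMr ?exprn_gt0// mul1r.
by apply: ler_wiXn2l; [exact: ltW|exact: ltW|exact: ltnW].
Qed.

Let Vn n : 0 <= theta ^- n :> R.
Proof. by rewrite invr_ge0 exprn_ge0//; case/andP: theta01 => /ltW. Qed.

Lemma transfer_cyl_ind n b y x :
  P (cyl_ind n.+1 (scons b y)) x = expR (phip (scons b x)) * cyl_ind n y x.
Proof.
rewrite /transfer (bigD1 b)//= big1 ?addr0 => [|c cb]; last first.
  by rewrite cyl_indN ?mulr0// => /(_ 0%N isT) /= e; rewrite e eqxx in cb.
congr (_ * _); have [h|h] := pselect (agree n x y).
  by rewrite !cyl_indE//; exact: agree_scons.
by rewrite !cyl_indN// => h'; apply: h => i lt_in; exact: (h' i.+1).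
Qed.

Definition gibbs_mass n y := gibbs (cyl_ind n y).

Lemma gibbs_mass_weights : invariant_weights gibbs_mass.
Proof.
split.
- move=> n y; rewrite -(gibbs_cst 0).
  have v0 : var_le theta 0 (fun _ : nat -> S => 0 : R).
    by move=> k x x' _; rewrite subrr normr0 mul0r.
  apply: (gibbs_le v0 (lexx 0) (@var_le_cyl_ind n y) (Vn n)) => x.
  by have /andP[] := cyl_ind_01 n y x.
- by move=> n x y xy; rewrite /gibbs_mass /cyl_ind (pcyl_agree xy).
- move=> y; rewrite /gibbs_mass -[RHS](gibbs_cst 1); congr gibbs.
  by apply/funext => x; rewrite cyl_indE.
- move=> n y; rewrite /gibbs_mass -(gibbs_sum (C := theta ^- n.+1))//; last first.
    by move=> c; exact: var_le_cyl_ind.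
  congr gibbs; apply/funext => x.
  rewrite (bigD1 (x n))//= big1 ?addr0 => [|c cx]; last first.
    rewrite cyl_indN// => /(_ n (ltnSn n)); rewrite /snoc eqxx => e.
    by rewrite e eqxx in cx.
  have [h|h] := pselect (agree n x y).
    rewrite !cyl_indE//; apply: agree_trans (snoc_agree _ h).
    exact/agree_sym/snoc_last.
  rewrite !cyl_indN// => h'; apply: h => i lt_in.
  by rewrite (h' i (leqW lt_in)) /snoc ltn_eqF.
- move=> n y; rewrite /gibbs_mass -(gibbs_sum (C := theta ^- n.+1))//; last first.
    by move=> c; exact: var_le_cyl_ind.
  have vs : var_le theta (\sum_(b : S) theta ^- n.+1)
      (fun x => \sum_b cyl_ind n.+1 (scons b y) x).
    move=> k x x' xx'; rewrite -sumrB mulr_suml.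
    apply: le_trans (ler_norm_sum _ _ _) _; apply: ler_sum => b _.
    exact: var_le_cyl_ind.
  rewrite -(gibbs_transfer vs); last exact: sumr_ge0.
  congr gibbs; apply/funext => x.
  transitivity (\sum_b P (cyl_ind n.+1 (scons b y)) x).
    rewrite -[LHS]mul1r -(phip_norm x) mulr_suml.
    by apply: eq_bigr => b _; rewrite transfer_cyl_ind.
  rewrite /transfer exchange_big/=.
  by apply: eq_bigr => b _; rewrite mulr_sumr.
Qed.

Lemma gibbs_mass_le n b y : gibbs_mass n.+1 (scons b y) <=
  expR (phip (scons b y) + Np * theta ^+ n.+1) * gibbs_mass n y.
Proof.
rewrite /gibbs_mass.
have vn := @var_le_cyl_ind n y; have vb := @var_le_cyl_ind n.+1 (scons b y).
have F1 x : `|cyl_ind n.+1 (scons b y) x| <= 1.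
  by have /andP[? ?] := cyl_ind_01 n.+1 (scons b y) x; rewrite ger0_norm.
have vP := var_le_transfer theta01 Np0 phip_var phip_norm (Vn n.+1) F1 vb.
rewrite -(gibbs_transfer vb)// -(gibbs_scale _ vn)//.
set c := expR _.
have vc : var_le theta (c * theta ^- n) (fun x => c * cyl_ind n y x).
  move=> k x x' xx'; rewrite -mulrBr normrM ger0_norm ?expR_ge0// -mulrA.
  by rewrite ler_wpM2l ?expR_ge0//; exact: vn.
apply: (gibbs_le vP _ vc).
- by rewrite addr_ge0// !mulr_ge0.
- by rewrite mulr_ge0// expR_ge0.
move=> x; rewrite transfer_cyl_ind.
have [h|h] := pselect (agree n x y); last by rewrite cyl_indN// !mulr0.
rewrite cyl_indE// !mulr1 ler_expR -lerBlDl.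
by apply: le_trans (ler_norm _) _; apply: phip_var; exact: agree_scons.
Qed.

End GibbsWeights.

Lemma equilibrium_expect_transfer (R : realType) (S : finPointedType)
    (theta Np K rho : R) (phip : (nat -> S) -> R)
    (mu : probability (seqspace S) R) :
  0 < theta < 1 -> 0 <= Np -> var_le theta Np phip ->
  (forall x, \sum_(b : S) expR (phip (scons b x)) = 1) ->
  0 <= rho < 1 ->
  (forall f C, var_le theta C f -> 0 <= C -> forall n x y,
    `|iter n (transfer phip) f x - iter n (transfer phip) f y| <= C * K * rho ^+ n) ->
  equilibrium_state phip mu ->
  forall f C F, 0 <= C -> (forall x, `|f x| <= F) -> var_le theta C f ->
  expect mu (transfer phip f) = expect mu f.
Proof.
move=> t01 Np0 phip_var phip_norm rho01 decay [mu_inv mu_max] f C F C0 fF fC.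
have hM := gibbs_mass_weights t01 phip_norm rho01 decay.
have [nu nuM] := weights_probability hM.
have nu_inv := weights_shift_invariant hM nuM.
have nuW := cyl_mass_weights nu_inv.
have nuE : cyl_mass nu = gibbs_mass phip.
  by apply/funext => n; apply/funext => y; rewrite /cyl_mass nuM.
have nuP : 0 <= entropy_rate (cyl_mass nu) + expect nu phip.
  apply: (@gibbs_pressure_ge0 R S theta Np) => //.
  - by move=> g D gD n; exact: expect_approx.
  - by move=> n b y; rewrite nuE; exact: gibbs_mass_le decay _ _ _.
have muP : 0 <= entropy_rate (cyl_mass mu) + expect mu phip.
  by apply: le_trans nuP _; rewrite -!ks_entropyE//; exact: mu_max.
apply: (equilibrium_transfer t01 Np0 phip_var phip_norm (cyl_mass_weights mu_inv)) fF fC muP => //.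
by move=> g D gD n; exact: expect_approx.
Qed.

Lemma expect_dist_le (R : realType) (S : finPointedType)
    (mu : probability (seqspace S) R) (theta C B : R) (g : (nat -> S) -> R) :
  0 < theta < 1 -> var_le theta C g -> (forall x y, `|g x - g y| <= B) ->
  forall x, `|g x - expect mu g| <= B.
Proof.
move=> t01 gC gB x.
have mg := var_le_integrable mu t01 gC.
have [m1 e1] := expect_cst mu (g x - B); have [m2 e2] := expect_cst mu (g x + B).
have h1 : g x - B <= expect mu g.
  rewrite -[leLHS]e1; apply: le_Rintegral => // y _.
  by have := gB x y; rewrite ler_norml => /andP[_]; lra.
have h2 : expect mu g <= g x + B.
  rewrite -[leRHS]e2; apply: le_Rintegral => // y _.
  by have := gB x y; rewrite ler_norml => /andP[+ _]; lra.
by rewrite ler_norml; lra.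
Qed.

Theorem theorem1 (R : realType) (S : finPointedType) (theta : R)
  (htheta : 0 < theta < 1)
  (phip : (nat -> S) -> R) (Np : R) (hNp1 : 1 <= Np)
  (hNp_sup : forall x, `|phip x| <= Np)
  (hNp_lip : forall x y, `|phip x - phip y| <= Np * dist theta x y)
  (hnormalized : forall x, \sum_(b : S) expR (phip (scons b x)) = 1)
  (mu : probability (seqspace S) R) (hmu : equilibrium_state phip mu)
  (phi : (nat -> S) -> R) (N : R) (hN1 : 1 <= N)
  (hN_sup : forall x, `|phi x| <= N)
  (hN_lip : forall x y, `|phi x - phi y| <= N * dist theta x y)
  (eps : R) (z0 : R) :
  let a := 1 - expR (- (Np / (1 - theta))) in
  0 < eps < Num.min (1 - a) (1 - theta) ->
  let U := ln (1 - eps) /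
           (ln (theta * eps * (1 - eps - theta)) - ln (2 * Np)) in
  1 < z0 < Num.min (Num.min (((a + eps / 2) / a) `^ U) ((theta + eps) / theta))
                   (Num.min ((1 - eps) / theta) (expR 2)) ->
  forall (n : nat) (x : nat -> S),
    `|iter n (transfer phip) (fun y => phi y - expect mu phi) x|
      <= (Num.sqrt z0) ^- n / (ln (Num.sqrt z0) * (1 - a - eps)) * N.
Proof.
move=> a heps U /andP[z1]; rewrite !lt_min => /andP[/andP[zU zt] /andP[ze z2]] n x.
have /andP[t0 t1] := htheta.
have t01 : 0 <= theta <= 1 by rewrite !ltW.
have Np0 : 0 <= Np by exact: le_trans hNp1.
have N0 : 0 <= N by exact: le_trans hN1.
have phip_var := lip_var_le t01 Np0 hNp_lip.
have phi_var := lip_var_le t01 N0 hN_lip.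
have zp : 0 < z0 by exact: lt_trans z1.
have c1 : a + eps < 1.
  by move: heps => /andP[_]; rewrite lt_min => /andP[+ _]; lra.
have tz : theta * z0 <= 1.
  by move: ze; rewrite ltr_pdivlMr// mulrC; case/andP: heps => ? _; lra.
have genfun := fail_genfun_le htheta hNp1 heps z1 zU zt ze.
have decay f C : var_le theta C f -> 0 <= C -> forall n x y,
    `|iter n (transfer phip) f x - iter n (transfer phip) f y| <=
    C * (1 - (a + eps))^-1 * z0^-1 ^+ n.
  move=> fC C0 k u v; rewrite exprVn.
  exact: (iter_transfer_decay htheta Np0 phip_var hnormalized fC C0 c1 (ltW z1) tz genfun).
have z01 : 0 <= z0^-1 < 1 by rewrite invr_ge0 ltW//= invf_lt1.
have inv := equilibrium_expect_transfer htheta Np0 phip_var hnormalized z01 decay hmu.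
have Pn k : exists2 C, 0 <= C & var_le theta C (iter k (transfer phip) phi).
  elim: k => [|k [C C0 hC]]; first by exists N.
  have kN := iter_transfer_bound hnormalized k hN_sup.
  exists (C + N * 2 * Np); first by rewrite addr_ge0// !mulr_ge0.
  exact: (var_le_transfer htheta Np0 phip_var hnormalized C0 kN hC).
have EP k : expect mu (iter k (transfer phip) phi) = expect mu phi.
  elim: k => //= k <-; have [C C0 hC] := Pn k.
  exact: (inv _ _ _ C0 (iter_transfer_bound hnormalized k hN_sup) hC).
have -> : iter n (transfer phip) (fun y => phi y - expect mu phi) x =
    iter n (transfer phip) phi x - expect mu (iter n (transfer phip) phi).
  rewrite EP; move: x; elim: n => //= n IH x.
  rewrite (funext IH) -[in LHS](mulr1 (expect mu phi)).
  by rewrite (transfer_scale_sub _ _ _ (fun=> 1)) transfer_cst// mulr1.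
have [C C0 hC] := Pn n.
apply: le_trans (expect_dist_le mu htheta hC (decay _ _ phi_var N0 n) x) _.
set s := Num.sqrt z0.
have s0 : 0 < s by rewrite sqrtr_gt0.
have sz : z0 = s ^+ 2 by rewrite sqr_sqrtr// ltW.
have s1 : 1 < s by rewrite -(@ltr_pXn2r _ 2) ?nnegrE ?(ltW s0)// expr1n -sz.
have ls0 : 0 < ln s by exact: ln_gt0.
have ls1 : ln s <= 1.
  rewrite -[leRHS]expRK ler_ln ?posrE ?expR_gt0//.
  rewrite -(@ler_pXn2r _ 2) ?nnegrE ?expR_ge0 ?(ltW s0)// -sz -expRM_natl mulr1.
  exact: ltW.
have ae : 0 < 1 - a - eps by lra.
have -> : 1 - (a + eps) = 1 - a - eps by ring.
rewrite -[leLHS]mulrA mulrC ler_wpM2r// exprVn mulrC ler_pM//.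
- by rewrite invr_ge0 exprn_ge0// ltW.
- by rewrite invr_ge0 ltW.
- rewrite sz lef_pV2 ?posrE ?exprn_gt0// -exprM ler_weXn2l// ?ltW//.
  by rewrite leq_pmull.
by rewrite lef_pV2 ?posrE ?mulr_gt0// ler_piMl// ltW.
Qed.
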